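(* Let $E\to M$ be a smooth vector bundle of rank at least $2$. For any $k\ge1$ there is an exact sequence of vector bundles $$0\longrightarrow\mathrm{Hom}(\wedge^kE,E)\stackrel{\mathrm{i}}{\longrightarrow}\mathrm{Hom}(\wedge^k\mathfrak{J}E,E)_{\mathfrak{D}E}\stackrel{\mathrm{j}}{\longrightarrow}\mathrm{Hom}(\wedge^{k-1}E,TM)\longrightarrow0,$$ where $\mathrm{i}(\Phi)(\mu_1,\dots,\mu_k)=\Phi(\mathrm{p}\mu_1,\dots,\mathrm{p}\mu_k)$ for $\Phi\in\mathrm{Hom}(\wedge^kE,E)$ and $\mu_1,\dots,\mu_k\in\mathfrak{J}E$, and $\mathrm{j}(\mathfrak d)=\lambda_{\mathfrak d}$ is the unique element of $\mathrm{Hom}(\wedge^{k-1}E,TM)$ satisfying $\mathfrak d(\mu_1\wedge\cdots\wedge\mu_{k-1}\wedge\eta)=\eta\circ\lambda_{\mathfrak d}(\mathrm{p}\mu_1\wedge\cdots\wedge\mathrm{p}\mu_{k-1})$ for all $\mu_i\in\mathfrak{J}E$ and $\eta\in\mathrm{Hom}(TM,E)$.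
   Context: $\mathfrak{D}E$ is the gauge Lie algebroid (covariant differential operator bundle) of $E$: the vector bundle whose sections are the $\mathbb{R}$-linear maps $\mathfrak d:\Gamma(E)\to\Gamma(E)$ for which there is a vector field $\mathrm{j}(\mathfrak d)$ on $M$ with $\mathfrak d(fu)=f\,\mathfrak d u+\mathrm{j}(\mathfrak d)(f)u$ for $f\in C^\infty(M)$, $u\in\Gamma(E)$. $\mathfrak{J}E$ is the first jet bundle of $E$, with projection $\mathrm{p}:\mathfrak{J}E\to E$, $[u]_m\mapsto u(m)$; its kernel is identified with $\mathrm{Hom}(TM,E)=T^*M\otimes E$, in such a way that $\mathrm{d}f\otimes u=\mathbf{d}(fu)-f\,\mathbf{d}u$, where $\mathbf{d}u\in\Gamma(\mathfrak{J}E)$ denotes the 1-jet prolongation of $u\in\Gamma(E)$. There is a nondegenerate $E$-valued pairing $\langle\mu,\mathfrak d\rangle_E=\mathfrak d u$ for $\mu=[u]_m\in\mathfrak{J}E$ and $\mathfrak d\in\mathfrak{D}E$; for $\eta\in\mathrm{Hom}(TM,E)\subset\mathfrak{J}E$ one has $\langle\eta,\mathfrak d\rangle_E=\eta(\mathrm{j}(\mathfrak d))$. Via this pairing $\mathfrak{D}E\subset\mathrm{Hom}(\mathfrak{J}E,E)$. For $k\ge2$, $\mathrm{Hom}(\wedge^k\mathfrak{J}E,E)_{\mathfrak{D}E}$ is the set of $\mathfrak d\in\mathrm{Hom}(\wedge^k\mathfrak{J}E,E)$ such that the map $\mathfrak d_\natural:\wedge^{k-1}\mathfrak{J}E\to\mathrm{Hom}(\mathfrak{J}E,E)$,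 $\mathfrak d_\natural(\mu_1,\dots,\mu_{k-1})(\mu_k)=\mathfrak d(\mu_1,\dots,\mu_k)$, has image in $\mathfrak{D}E$. For $k=1$, $\mathrm{Hom}(\mathfrak{J}E,E)_{\mathfrak{D}E}=\mathfrak{D}E$ and $\wedge^0E$ is the trivial line bundle. *)

(* Defs.v *)
From HB Require Import structures.
From mathcomp Require Import all_boot all_order all_algebra.
From mathcomp Require Import generic_quotient ring_quotient.
From mathcomp Require Import all_classical all_reals all_analysis.
Import Order.TTheory GRing.Theory Num.Theory numFieldNormedType.Exports.

Set Implicit Arguments.
Unset Strict Implicit.
Unset Printing Implicit Defensive.

Local Open Scope classical_set_scope.
Local Open Scope ring_scope.
Local Open Scope quotient_scope.

Record subspace (R : realType) (V : lmodType R) := Subspace {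
  sp_set : set V;
  sp_closed : [/\ sp_set 0, (forall x y, sp_set x -> sp_set y -> sp_set (x + y))
                & (forall (c : R) x, sp_set x -> sp_set (c *: x))] }.

Section SubspaceType.
Variables (R : realType) (V : lmodType R) (S : subspace V).

Definition sp_pred : {pred V} := fun x => `[< sp_set S x >].

Lemma sp_submod_closed : submod_closed sp_pred.
Proof.
have [S0 SD SZ] := sp_closed S; split; first exact/asboolP.
by move=> c x y /asboolP Sx /asboolP Sy; apply/asboolP/SD => //; exact: SZ.
Qed.

HB.instance Definition _ :=
  GRing.isSubmodClosed.Build R V sp_pred sp_submod_closed.

Record subsp := Subsp { sp_val :> V; sp_valP : sp_val \in sp_pred }.

HB.instance Definition _ := [isSub for sp_val].
HB.instance Definition _ := [Choice of subsp by <:].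
HB.instance Definition _ :=
  GRing.SubChoice_isSubLmodule.Build R V sp_pred subsp sp_submod_closed.

Definition quotsp := Quotient.quot sp_pred.
HB.instance Definition _ := GRing.Zmodule.on quotsp.
HB.instance Definition _ := EqQuotient.on quotsp.

Lemma piB (x y : V) : sp_set S (x - y) -> \pi_quotsp x = \pi_quotsp y.
Proof.
move=> Sxy; apply/eqP; rewrite -Quotient.idealrBE. exact/asboolP.
Qed.

Lemma piBP (x y : V) : \pi_quotsp x = \pi_quotsp y -> sp_set S (x - y).
Proof. by move/eqP; rewrite -Quotient.idealrBE => /asboolP. Qed.

Definition quotsp_scale (c : R) (x : quotsp) : quotsp :=
  \pi_quotsp (c *: repr x).

Lemma pi_scale (c : R) (x : V) :
  quotsp_scale c (\pi_quotsp x) = \pi_quotsp (c *: x).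
Proof.
have [_ _ SZ] := sp_closed S; apply: piB; rewrite -scalerBr; apply: SZ.
by apply: piBP; rewrite reprK.
Qed.

Lemma pi_add (x y : V) : \pi_quotsp (x + y) = \pi_quotsp x + \pi_quotsp y.
Proof. exact: (@Quotient.pi_add V sp_pred). Qed.

Fact quotsp_scaleA (a b : R) x :
  quotsp_scale a (quotsp_scale b x) = quotsp_scale (a * b) x.
Proof. by elim/quotW: x => x; rewrite (pi_scale b x) !pi_scale scalerA. Qed.

Fact quotsp_scale1 : left_id 1 quotsp_scale.
Proof. by elim/quotW=> x; rewrite pi_scale scale1r. Qed.

Fact quotsp_scaleDr : right_distributive quotsp_scale +%R.
Proof.
move=> c; elim/quotW=> x; elim/quotW=> y.
by rewrite -pi_add !pi_scale scalerDr pi_add.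
Qed.

Fact quotsp_scaleDl x : {morph quotsp_scale^~ x : a b / a + b}.
Proof.
by elim/quotW: x => x a b; rewrite !pi_scale scalerDl pi_add.
Qed.

HB.instance Definition _ := GRing.Zmodule_isLmodule.Build R quotsp
  quotsp_scaleA quotsp_scale1 quotsp_scaleDr quotsp_scaleDl.

End SubspaceType.

Section DependentSections.
Variables (R : realType) (T : Type) (F : T -> lmodType R).

Definition dsec := forall m, F m.

HB.instance Definition _ := gen_eqMixin dsec.
HB.instance Definition _ := gen_choiceMixin dsec.

Let dadd (s t : dsec) : dsec := fun m => s m + t m.
Let dopp (s : dsec) : dsec := fun m => - s m.
Let dzero : dsec := fun m => 0.
Let dscale (c : R) (s : dsec) : dsec := fun m => c *: s m.

Fact daddA : associative dadd.
Proof. by move=> s t w; apply: functional_extensionality_dep => m; exact: addrA. Qed.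
Fact daddC : commutative dadd.
Proof. by move=> s t; apply: functional_extensionality_dep => m; exact: addrC. Qed.
Fact dadd0 : left_id dzero dadd.
Proof. by move=> s; apply: functional_extensionality_dep => m; exact: add0r. Qed.
Fact daddN : left_inverse dzero dopp dadd.
Proof. by move=> s; apply: functional_extensionality_dep => m; exact: addNr. Qed.

HB.instance Definition _ := GRing.isZmodule.Build dsec daddA daddC dadd0 daddN.

Fact dscaleA a b s : dscale a (dscale b s) = dscale (a * b) s.
Proof. by apply: functional_extensionality_dep => m; exact: scalerA. Qed.
Fact dscale1 : left_id 1 dscale.
Proof. by move=> s; apply: functional_extensionality_dep => m; exact: scale1r. Qed.
Fact dscaleDr : right_distributive dscale +%R.
Proof. by move=> c s t; apply: functional_extensionality_dep => m; exact: scalerDr. Qed.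
Fact dscaleDl s : {morph dscale^~ s : a b / a + b}.
Proof. by move=> a b; apply: functional_extensionality_dep => m; exact: scalerDl. Qed.

HB.instance Definition _ := GRing.Zmodule_isLmodule.Build R dsec
  dscaleA dscale1 dscaleDr dscaleDl.

End DependentSections.

Section Ck.
Variables (R : realType) (n : nat).
Implicit Types (U : set 'rV[R]_n) (f g : 'rV[R]_n -> R).

(* All iterated partial derivatives of order at most [k] exist and are
   continuous on [U]; only meaningful for open [U]. *)
Fixpoint Ck (k : nat) U f : Prop :=
  (forall x, U x -> {for x, continuous f}) /\
  if k is k'.+1 then
    forall i : 'I_n, (forall x, U x -> derivable f x (delta_mx 0 i)) /\
      Ck k' U (fun x => 'D_(delta_mx 0 i) f x)
  else True.

Definition smooth_on U f := forall k, Ck k U f.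

Lemma Ck_le k U f : Ck k.+1 U f -> Ck k U f.
Proof.
elim: k f => [|k IH] f [cf df]; split=> // i.
by have [dfi cdf] := df i; split=> //; exact: IH.
Qed.

Lemma Ck_sub k U V f : U `<=` V -> Ck k V f -> Ck k U f.
Proof.
move=> UV; elim: k f => [|k IH] f [cf df].
all: split; first by move=> x Ux; exact/cf/UV.
- by [].
move=> i; have [dfi cdf] := df i; split; last exact: IH.
by move=> x Ux; exact/dfi/UV.
Qed.

Lemma Ck_eq k U f g : open U -> (forall x, U x -> f x = g x) ->
  Ck k U f -> Ck k U g.
Proof.
move=> oU; elim: k f g => [|k IH] f g fg [cf df].
all: have nfg x : U x -> {near x, f =1 g}
  by move=> Ux; apply: filterS (open_nbhs_nbhs (conj oU Ux)) => y Uy; exact: fg.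
all: split; first by move=> x Ux; have := cf _ Ux;
  rewrite /prop_for /continuous_at -(fg x Ux);
  apply: cvg_trans; exact: near_eq_cvg (nfg x Ux).
- by [].
move=> i; have [dfi cdf] := df i; split.
  by move=> x Ux; apply: near_eq_derivable (dfi x Ux); exact: nfg.
by apply: IH cdf => x Ux; apply: near_eq_derive; exact: nfg.
Qed.

Lemma Ck_cst k U (c : R) : Ck k U (fun=> c).
Proof.
elim: k c => [|k IH] c; (split; first by move=> x _; exact: cst_continuous) => //.
move=> i; split; first by move=> x _; apply: (@derivable_cst R _ R^o c).
rewrite [X in Ck _ _ X](_ : _ = fun=> 0); first exact: IH.
by apply: functional_extensionality_dep => x; exact: (@derive_cst R _ R^o).
Qed.

Lemma Ck_add k U f g : open U -> Ck k U f -> Ck k U g ->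
  Ck k U (fun x => f x + g x).
Proof.
move=> oU; elim: k f g => [|k IH] f g [cf df] [cg dg].
all: split; first by move=> x Ux; apply: continuousD; [exact: cf | exact: cg].
- by [].
move=> i; have [dfi cdf] := df i; have [dgi cdg] := dg i; split.
  by move=> x Ux; apply: derivableD; [exact: dfi | exact: dgi].
apply: (Ck_eq oU) (IH _ _ cdf cdg) => x Ux.
by apply/esym/deriveD; [exact: dfi | exact: dgi].
Qed.

Lemma Ck_mul k U f g : open U -> Ck k U f -> Ck k U g ->
  Ck k U (fun x => f x * g x).
Proof.
move=> oU; elim: k f g => [|k IH] f g Cf Cg.
all: have [cf df] := Cf; have [cg dg] := Cg.
all: split; first by move=> x Ux; apply: continuousM; [exact: cf | exact: cg].
- by [].
move=> i; have [dfi cdf] := df i; have [dgi cdg] := dg i; split.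
  by move=> x Ux; apply: derivableM; [exact: dfi | exact: dgi].
have := Ck_add oU (IH _ _ (Ck_le Cf) cdg) (IH _ _ (Ck_le Cg) cdf).
apply: (Ck_eq oU) => x Ux.
by apply/esym/deriveM; [exact: dfi | exact: dgi].
Qed.

End Ck.

(* The atlas need not be maximal.  [cinv a] is the inverse of the chart
   [cmap a : cdom a -> R^n], with arbitrary values off the image. *)
Record manifold (R : realType) (n : nat) := Manifold {
  mcarrier :> topologicalType;
  m_hausdorff : hausdorff_space mcarrier;
  m_second_countable : @second_countable mcarrier;
  cidx : Type;
  cdom : cidx -> set mcarrier;
  cmap : cidx -> mcarrier -> 'rV[R]_n;
  cinv : cidx -> 'rV[R]_n -> mcarrier;
  cdom_open : forall a, open (cdom a);
  cdom_cover : forall m, exists a, cdom a m;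
  cim_open : forall a, open (cmap a @` cdom a);
  cmapK : forall a m, cdom a m -> cinv a (cmap a m) = m;
  cmap_continuous : forall a m, cdom a m -> {for m, continuous (cmap a)};
  cinv_continuous : forall a x,
    (cmap a @` cdom a) x -> {for x, continuous (cinv a)};
  transition_smooth : forall a b (i : 'I_n),
    smooth_on (cmap a @` (cdom a `&` cdom b))
              (fun x => cmap b (cinv a x) 0 i) }.

Arguments cdom_open {R n} M a : rename.
Arguments cim_open {R n} M a : rename.

Section Manifold.
Variables (R : realType) (n : nat) (M : manifold R n).
Implicit Types (U : set M) (f g : M -> R).

Definition smooth_fun U f :=
  forall a, smooth_on (cmap a @` (U `&` cdom a)) (f \o @cinv R n M a).

Lemma chart_open U a : open U -> open (cmap a @` (U `&` @cdom R n M a)).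
Proof.
move=> oU; rewrite openE => x [m [Um am] <-]; rewrite /interior.
have ix : (cmap a @` @cdom R n M a) (cmap a m) by exists m.
have nU : nbhs (cinv a (cmap a m)) U.
  by rewrite cmapK //; exact: open_nbhs_nbhs.
have := cinv_continuous ix nU.
move/(filterI (open_nbhs_nbhs (conj (cim_open _ a) ix))).
apply: filterS => y [[p ap <-]] /=.
by rewrite cmapK // => Up; exists p.
Qed.

Lemma smooth_fun_cst U (c : R) : smooth_fun U (fun=> c).
Proof. by move=> a k; exact: Ck_cst. Qed.

Lemma smooth_fun_add U f g : open U -> smooth_fun U f -> smooth_fun U g ->
  smooth_fun U (fun m => f m + g m).
Proof.
by move=> oU sf sg a k; apply: Ck_add; [exact: chart_open|exact: sf|exact: sg].
Qed.

Lemma smooth_fun_mul U f g : open U -> smooth_fun U f -> smooth_fun U g ->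
  smooth_fun U (fun m => f m * g m).
Proof.
by move=> oU sf sg a k; apply: Ck_mul; [exact: chart_open|exact: sf|exact: sg].
Qed.

Record Cinf := CInf { cval :> M -> R; cvalP : smooth_fun setT cval }.

(* df/dx_i at [m], in the chart [a] *)
Definition partial a (i : 'I_n) (f : M -> R) (m : M) : R :=
  'D_(delta_mx 0 i) (f \o @cinv R n M a) (cmap a m).

(* Tangent vectors at [m], as operators [f |-> sum_i c_i df/dx_i (m)]; by the
   chain rule an operator of this form in one chart around [m] has this form
   in all of them. *)
Definition tangent_set (m : M) : set (Cinf -> R) :=
  [set v | forall a, cdom a m ->
     exists c : 'I_n -> R, forall f : Cinf, v f = \sum_i c i * partial a i f m].

Fact tangent_closed m : [/\ tangent_set m 0,
  (forall v w, tangent_set m v -> tangent_set m w -> tangent_set m (v + w)) &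
  (forall c v, tangent_set m v -> tangent_set m (c *: v))].
Proof.
split=> [a am|v w tv tw a am|c v tv a am].
- by exists (fun=> 0) => f; rewrite big1 // => i _; rewrite mul0r.
- have [c vE] := tv a am; have [d wE] := tw a am; exists (fun i => c i + d i).
  move=> f; rewrite [LHS](_ : _ = v f + w f) // vE wE -big_split /=.
  by apply: eq_bigr => i _; rewrite mulrDl.
- have [d vE] := tv a am; exists (fun i => c * d i) => f.
  rewrite [LHS](_ : _ = c * v f) // vE mulr_sumr.
  by apply: eq_bigr => i _; rewrite mulrA.
Qed.

Definition tangent (m : M) : lmodType R := subsp (Subspace (tangent_closed m)).

Definition tangent_app m (v : tangent m) (f : Cinf) : R := sp_val v f.

End Manifold.

Section VectorBundle.
Variables (R : realType) (n : nat) (M : manifold R n).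

Definition is_basis (V : lmodType R) (r : nat) (e : 'I_r -> V) :=
  forall x : V, exists! c : 'I_r -> R, x = \sum_i c i *: e i.

(* A smooth vector bundle structure of rank [r] on a family of vector spaces,
   given by local frames covering [M] with smooth transition functions; the
   values of [frame a] off [fdom a] are irrelevant. *)
Record vb_atlas (r : nat) (F : M -> lmodType R) := VBAtlas {
  fidx : Type;
  fdom : fidx -> set M;
  frame : fidx -> 'I_r -> forall m, F m;
  fdom_open : forall a, open (fdom a);
  fdom_cover : forall m, exists a, fdom a m;
  frame_basis : forall a m, fdom a m -> is_basis (fun i => frame a i m);
  frame_transition : forall a b i, exists2 g : 'I_r -> M -> R,
    (forall j, smooth_fun (fdom a `&` fdom b) (g j)) &
    forall m, fdom a m -> fdom b m ->
      frame b i m = \sum_j g j m *: frame a j m }.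

Arguments fdom_open {r F} A a : rename.

Definition smooth_section r F (A : vb_atlas r F) (s : forall m, F m) :=
  forall a : fidx A, exists2 g : 'I_r -> M -> R,
    (forall j, smooth_fun (fdom a) (g j)) &
    forall m, fdom a m -> s m = \sum_j g j m *: frame a j m.

(* A family of vector spaces with a set of sections to be regarded as the
   smooth ones.  It is a smooth vector bundle when that set is the set of all
   smooth sections for some vector bundle structure, which it determines. *)
Record vfamily := VFamily {
  vfam :> M -> lmodType R;
  vsec : set (forall m, vfam m) }.

Arguments vsec : clear implicits.

Definition is_vector_bundle (B : vfamily) :=
  exists r (A : vb_atlas r B), vsec B = [set s | smooth_section A s].

Definition smooth_bundle_map (B C : vfamily)
    (phi : forall m, {linear B m -> C m}) :=
  forall s, vsec B s -> vsec C (fun m => phi m (s m)).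

Definition short_exact_sequence (A B C : vfamily)
    (i : forall m, {linear A m -> B m}) (j : forall m, {linear B m -> C m}) :=
  [/\ [/\ is_vector_bundle A, is_vector_bundle B & is_vector_bundle C],
      smooth_bundle_map i /\ smooth_bundle_map j &
      forall m, [/\ injective (i m),
        (forall y, j m y = 0 <-> exists x, i m x = y) &
        (forall z, exists y, j m y = z)]].

Definition TM : vfamily := @VFamily (@tangent R n M)
  [set X | forall f : Cinf M, smooth_fun setT (fun m => tangent_app (X m) f)].

Section Alternating.
Variables (k : nat) (V W : lmodType R).

Definition subst_at (mu : 'I_k -> V) (i : 'I_k) (x : V) : 'I_k -> V :=
  fun j => if j == i then x else mu j.

Definition alt_set : set (('I_k -> V) -> W) := [set phi |
  (forall mu i, linear (fun x => phi (subst_at mu i x))) /\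
  (forall mu i j, i != j -> mu i = mu j -> phi mu = 0)].

Fact alt_closed : [/\ alt_set 0,
  (forall f g, alt_set f -> alt_set g -> alt_set (f + g)) &
  (forall c f, alt_set f -> alt_set (c *: f))].
Proof.
split=> [|f g [fl fa] [gl ga]|c f [fl fa]]; split.
- by move=> mu i c x y; rewrite scaler0 addr0.
- by [].
- move=> mu i c x y; rewrite [LHS]/GRing.add /= fl gl.
  by rewrite [in RHS]/GRing.add /= scalerDr addrACA.
- move=> mu i j ij e; rewrite [LHS](_ : _ = f mu + g mu) //.
  by rewrite (fa mu i j) // (ga mu i j) // addr0.
- move=> mu i d x y; rewrite [LHS](_ : _ = c *: f (subst_at mu i (d *: x + y))) //.
  by rewrite fl scalerDr !scalerA mulrC -scalerA.
- move=> mu i j ij e; rewrite [LHS](_ : _ = c *: f mu) //.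
  by rewrite (fa mu i j) // scaler0.
Qed.

(* Hom(/\^k V, W), as alternating k-linear maps V x ... x V -> W. *)
Definition alt : lmodType R := subsp (Subspace alt_closed).

Definition alt_app (phi : alt) (mu : 'I_k -> V) : W := sp_val phi mu.

End Alternating.

(* A section of Hom(/\^k B, C) is smooth when it maps smooth sections to smooth
   sections. *)
Definition HomAlt (k : nat) (B C : vfamily) : vfamily :=
  @VFamily (fun m => alt k (B m) (C m))
    [set Phi | forall s : 'I_k -> forall m, B m, (forall i, vsec B (s i)) ->
       vsec C (fun m => alt_app (Phi m) (fun i => s i m))].

(* The family (mu_1, ..., mu_(k-1), x), for k >= 1. *)
Definition snoc (k : nat) (V : Type) (mu : 'I_k.-1 -> V) (x : V) : 'I_k -> V :=
  fun i => if insub (i : nat) is Some j then mu j else x.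

Record vbundle (r : nat) := VBundle {
  vb_fib : M -> lmodType R;
  vb_str : vb_atlas r vb_fib }.

Definition vb_family r (E : vbundle r) : vfamily :=
  @VFamily (vb_fib E) [set s | smooth_section (vb_str E) s].
Coercion vb_family : vbundle >-> vfamily.

End VectorBundle.

Arguments vsec {R n M} v.

Section Jets.
Variables (R : realType) (n : nat) (M : manifold R n).
Variables (r : nat) (E : vbundle M r).

Definition Gamma_set : set (dsec E) := [set s | smooth_section (vb_str E) s].

Fact Gamma_closed : [/\ Gamma_set 0,
  (forall s t, Gamma_set s -> Gamma_set t -> Gamma_set (s + t)) &
  (forall c s, Gamma_set s -> Gamma_set (c *: s))].
Proof.
split=> [a|s t ss st a|c s ss a].
- exists (fun _ _ => 0) => [j|m am]; first exact: smooth_fun_cst.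
  by rewrite big1 // => j _; rewrite scale0r.
- have [g sg sE] := ss a; have [h sh tE] := st a.
  exists (fun j m => g j m + h j m) => [j|m am].
    by apply: smooth_fun_add; [exact: fdom_open | exact: sg | exact: sh].
  rewrite [LHS](_ : _ = s m + t m) // sE // tE // -big_split /=.
  by apply: eq_bigr => j _; rewrite scalerDl.
- have [g sg sE] := ss a; exists (fun j m => c * g j m) => [j|m am].
    apply: smooth_fun_mul; [exact: fdom_open|exact: smooth_fun_cst|exact: sg].
  rewrite [LHS](_ : _ = c *: s m) // sE // scaler_sumr.
  by apply: eq_bigr => j _; rewrite scalerA.
Qed.

Definition Gamma : lmodType R := subsp (Subspace Gamma_closed).

Definition sec_app (u : Gamma) (m : M) : E m := (sp_val u : dsec E) m.

Fact Gamma_mulP (f : Cinf M) (u : Gamma) :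
  ((fun m => f m *: sec_app u m) : dsec E) \in sp_pred (Subspace Gamma_closed).
Proof.
apply/asboolP => a; have /asboolP/(_ a)[g sg uE] := sp_valP u.
exists (fun j m => f m * g j m) => [j|m am].
  apply: smooth_fun_mul; [exact: fdom_open| |exact: sg].
  move=> b k; apply: Ck_sub (cvalP f b k); last by move=> _ [m [_ bm] <-]; exists m.
rewrite /sec_app uE // scaler_sumr.
by apply: eq_bigr => j _; rewrite scalerA.
Qed.

Definition Gamma_mul (f : Cinf M) (u : Gamma) : Gamma := Subsp (Gamma_mulP f u).

Record dual_section := DualSection {
  dual_val : forall m, {linear E m -> R^o};
  dual_valP : forall u : Gamma,
    smooth_fun setT (fun m => dual_val m (sec_app u m)) }.

Definition dual_pair (xi : dual_section) (u : Gamma) : Cinf M :=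
  CInf (dual_valP xi u).

(* Two sections have the same 1-jet at [m] when they agree at [m] and all
   tangent vectors at [m] agree on their components [<xi, u>]. *)
Definition jet_null_set (m : M) : set Gamma := [set u | sec_app u m = 0 /\
  forall (xi : dual_section) (v : tangent m), tangent_app v (dual_pair xi u) = 0].

Fact tangent_add m (v : tangent m) (f g h : Cinf M) (c : R) :
  (forall p, h p = c * f p + g p) ->
  tangent_app v h = c * tangent_app v f + tangent_app v g.
Proof.
move=> hE; have /asboolP tv := sp_valP v; have [a am] := cdom_cover m.
have [d vE] := tv a am; rewrite /tangent_app !vE mulr_sumr -big_split /=.
apply: eq_bigr => i _; rewrite mulrCA -mulrDr; congr (_ * _).
have D (k : Cinf M) : derivable (k \o @cinv R n M a) (cmap a m) (delta_mx 0 i).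
  have [_ /(_ i)[+ _]] := cvalP k a 1%N.
  by apply; exists m.
rewrite /partial (_ : (h \o _) = c \*: (f \o @cinv R n M a) + (g \o @cinv R n M a)).
  by rewrite deriveD ?deriveZ //; exact: derivableZ.
by apply/funext => x; exact: hE.
Qed.

Fact jet_null_closed m : [/\ jet_null_set m 0,
  (forall s t, jet_null_set m s -> jet_null_set m t -> jet_null_set m (s + t)) &
  (forall c s, jet_null_set m s -> jet_null_set m (c *: s))].
Proof.
have L c (s t : Gamma) : jet_null_set m s -> jet_null_set m t ->
    jet_null_set m (c *: s + t).
  move=> [s0 ds] [t0 dt]; split=> [|xi v].
    by rewrite [LHS](_ : _ = c *: sec_app s m + sec_app t m) // s0 t0 scaler0 addr0.
  rewrite (tangent_add v (f := dual_pair xi s) (g := dual_pair xi t) (c := c)).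
    by rewrite ds dt mulr0 addr0.
  by move=> p; exact: (linearP (dual_val xi p)).
have N0 : jet_null_set m 0.
  split=> // xi v; pose h := dual_pair xi 0.
  have h0 p : h p = 0 by exact: (linear0 (dual_val xi p)).
  have : tangent_app v h = 1 * tangent_app v h + tangent_app v h.
    by apply: tangent_add => p; rewrite h0 mulr0 addr0.
  by rewrite mul1r -[LHS]addr0 => /addrI/esym.
split=> // [s t ns nt|c s ns]; first by rewrite -[s]scale1r; exact: L.
by rewrite -[c *: s]addr0; exact: L.
Qed.

Definition Jet (m : M) : lmodType R := quotsp (Subspace (@jet_null_closed m)).

(* [u]_m *)
Definition jet (m : M) (u : Gamma) : Jet m := \pi_(Jet m) u.

(* p : JE -> E *)
Definition jet_proj (m : M) (mu : Jet m) : E m := sec_app (repr mu) m.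

Lemma jet_projE m u : jet_proj (jet m u) = sec_app u m.
Proof.
have := piBP (reprK (jet m u)) => -[+ _].
by rewrite [LHS](_ : _ = jet_proj (jet m u) - sec_app u m) // => /subr0_eq.
Qed.

(* Smooth sections of JE: locally, combinations of prolongations [du] with
   coefficients in C^oo(M). *)
Definition JE : vfamily M := @VFamily R n M Jet
  [set mu | forall m0, exists U : set M, [/\ open U, U m0 &
     exists N (f : 'I_N -> Cinf M) (u : 'I_N -> Gamma),
       forall m, U m -> mu m = \sum_i f i m *: jet m (u i)]].

(* df (x) u = d(fu) - f du at [m], where du is the 1-jet prolongation *)
Definition jet_df (m : M) (f : Cinf M) (u : Gamma) : Jet m :=
  jet m (Gamma_mul f u) - f m *: jet m u.

(* The inclusion Hom(TM, E) = T^*M (x) E -> JE, determined by its value on the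
   elements [df (x) u], which span Hom(TM, E): the image of
   [eta = sum_i df_i (x) u_i] is [sum_i (d(f_i u_i) - f_i du_i)], which does not
   depend on the decomposition; [xget] selects it, [0] being a dummy default. *)
Definition hom_jet (m : M) (eta : {linear tangent m -> E m}) : Jet m :=
  xget 0 [set mu | exists N (f : 'I_N -> Cinf M) (u : 'I_N -> Gamma),
    (forall v, eta v = \sum_i tangent_app v (f i) *: sec_app (u i) m) /\
    mu = \sum_i jet_df m (f i) (u i)].

Definition is_cdo (d : Gamma -> Gamma) := linear d /\
  exists2 X : forall m, TM M m, vsec (TM M) X & forall (f : Cinf M) (u : Gamma) m,
    sec_app (d (Gamma_mul f u)) m
      = f m *: sec_app (d u) m + tangent_app (X m) f *: sec_app u m.

(* The values at [m] of covariant differential operators, i.e. the fibre of DE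
   at [m], inside Hom(JE, E) via the pairing <[u]_m, d> = du. *)
Definition DE (m : M) : set (Jet m -> E m) := [set delta |
  exists2 d, is_cdo d & forall u, delta (jet m u) = sec_app (d u) m].

Fact DE0 m : DE (fun=> 0 : E m).
Proof.
exists (fun=> 0) => //; split; first by move=> c u v; rewrite scaler0 addr0.
exists (fun=> 0) => [f|f u m']; first exact: smooth_fun_cst.
by rewrite [sec_app 0 m'](_ : _ = 0) // scaler0 add0r scale0r.
Qed.

Fact DE_lin m c (delta eps : Jet m -> E m) : DE delta -> DE eps ->
  DE (fun x => c *: delta x + eps x).
Proof.
move=> [d [dl [X sX dX]] dE] [e [el [Y sY eY]] eE].
exists (fun u => c *: d u + e u) => [|u]; last by rewrite dE eE.
split.
  move=> b u v; rewrite dl el scalerDr addrACA scalerDr.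
  by congr (_ + _ + _); rewrite !scalerA mulrC.
exists (fun m => c *: X m + Y m) => [f|f u m'].
  apply: smooth_fun_add; [exact: openT| |exact: sY].
  by apply: smooth_fun_mul; [exact: openT|exact: smooth_fun_cst|exact: sX].
rewrite [LHS](_ : _ = c *: sec_app (d (Gamma_mul f u)) m' +
                      sec_app (e (Gamma_mul f u)) m') // dX eY.
rewrite [sec_app (_ + _) m'](_ : _ = c *: sec_app (d u) m' + sec_app (e u) m') //.
rewrite [tangent_app (_ + _) f](_ : _ = c * tangent_app (X m') f +
                                        tangent_app (Y m') f) //.
rewrite !scalerDr scalerDl addrACA.
by congr (_ + _ + _); rewrite !scalerA // mulrC.
Qed.

Definition natural_set (k : nat) (m : M) : set (alt k (Jet m) (E m)) :=
  [set d | forall mu : 'I_k.-1 -> Jet m, DE (fun x => alt_app d (snoc mu x))].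

Fact natural_closed k m : [/\ @natural_set k m 0,
  (forall d e, @natural_set k m d -> @natural_set k m e -> @natural_set k m (d + e)) &
  (forall c d, @natural_set k m d -> @natural_set k m (c *: d))].
Proof.
split=> [mu|d e nd ne mu|c d nd mu].
- exact: DE0.
- rewrite [X in DE X](_ : _ = fun x =>
    1 *: alt_app d (snoc mu x) + alt_app e (snoc mu x)); first exact: DE_lin.
  by apply/funext => x; rewrite scale1r.
- rewrite [X in DE X](_ : _ = fun x => c *: alt_app d (snoc mu x) + 0).
    by apply: DE_lin => //; exact: DE0.
  by apply/funext => x; rewrite addr0.
Qed.

(* Hom(/\^k JE, E)_DE; for k = 1, [snoc mu x] is the family (x) and the
   condition says that the map itself lies in DE. *)
Definition HomDE (k : nat) : vfamily M :=
  @VFamily R n M (fun m => subsp (Subspace (@natural_closed k m)))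
    [set d | vsec (HomAlt k JE E) (fun m => sp_val (d m))].

Definition DE_app (k : nat) (m : M) (d : HomDE k m) (mu : 'I_k -> Jet m) : E m :=
  alt_app (sp_val d) mu.

End Jets.

(* Main.v *)
From HB Require Import structures.
Require Import Defs.
From mathcomp Require Import all_boot all_order all_algebra.
From mathcomp Require Import all_classical all_reals all_analysis.
From mathcomp Require Import generic_quotient perm ring.
Import Order.TTheory GRing.Theory Num.Theory numFieldNormedType.Exports.
Set Implicit Arguments.
Unset Strict Implicit.
Unset Printing Implicit Defensive.
Local Open Scope classical_set_scope.
Local Open Scope ring_scope.

(** Exactness is a statement about one fibre, and it comes from the symbol.
The kernel of [jet_proj] at [m] is spanned by the elements [df (x) u], and a
linear map [delta : Jet m -> E m] is the value of a covariant differential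
operator exactly when there is a tangent vector [v], its symbol, with
[delta (df (x) u) = v(f) u(m)] ([DE_symbol], [symbol_DE]).  So an element [d]
of [Hom(/\^k JE, E)_DE] assigns to [mu_1, .., mu_(k-1)] the symbol [lam] of
[d (mu_1, .., mu_(k-1), _)], which is alternating and multilinear.  It depends
only on the values [jet_proj mu_i]: if [mu_i = dg (x) e], then exchanging it
with a last argument [df (x) e'] equates a multiple of [e'] with a multiple of
[e], and in rank at least two [e'] can be taken independent of [e], so that
both vanish ([jet_symbol_df]).  This is the map [j].  If the symbol of [d] is
zero, then [d] vanishes as soon as one argument lies in the kernel of
[jet_proj], and therefore comes from [Hom(/\^k E, E)] ([symbol0_factor]).  For
surjectivity ([lambda_surj]) a decomposable [(xi_1 /\ .. /\ xi_(k-1)) (x) v] is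
the symbol of [xi_1 /\ .. /\ xi_(k-1) /\ D], where [D] is a derivative along [v]
with respect to a local frame of [E]; this element is a determinant.

That the three families are smooth vector bundles rests on bump functions
([bump_function]).  They are used to cut off frames and coordinates so that
every local object becomes a global section, and a family is a vector bundle as
soon as its sections form a sheaf of modules with such local frames
([frames_vector_bundle]).  For [TM] this needs the chain rule, hence total
differentiability of [C^1] functions ([caratheodory]).  The bundles
[Hom(/\^k B, C)] and [Hom(/\^k JE, E)_DE] are treated together: local frames of
[B] and [C] identify their fibres with one fixed finite-dimensional space of
alternating maps between coordinate spaces, and a basis of that space gives the
frame ([alt_subbundle]).  For the second bundle the frame of [JE] consists of
the jets of a frame of [E] and of the products [dx_i (x) e] with coordinates
([jet_frame]); in it the symbol condition has constant coefficients
([natural_model]). *)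

(** * Differential calculus in coordinate space *)

Section Calculus.
Variable R : realType.

Lemma is_derive_line (V : normedModType R) (f : V -> R) (p v : V) (t : R) :
  derivable f (p + t *: v) v ->
  is_derive t 1 (fun s : R => f (p + s *: v)) ('D_v f (p + t *: v)).
Proof.
move=> df; have E : (fun h : R => h^-1 *: (((fun s => f (p + s *: v)) \o shift t)
      (h *: 1) - f (p + t *: v))) =
    (fun h => h^-1 *: ((f \o shift (p + t *: v)) (h *: v) - f (p + t *: v))).
  apply/funext => h /=; congr (_ *: (f _ - _)).
  by rewrite /shift /= [h *: 1]mulr1 scalerDl addrCA.
by apply: DeriveDef; rewrite /derivable /derive E.
Qed.

Lemma MVT_line (V : normedModType R) (f : V -> R) (p v : V) (h : R) : h != 0 ->
  (forall t, `|t| <= `|h| -> derivable f (p + t *: v) v) ->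
  exists2 t, `|t| <= `|h| & (f (p + h *: v) - f p) / h = 'D_v f (p + t *: v).
Proof.
move=> h0 df; pose g s := f (p + s *: v).
have dg (t : R) : `|t| <= `|h| -> is_derive t (1 : R) (g : R -> R) ('D_v f (p + t *: v)).
  by move=> /df/is_derive_line.
have cg (a b : R) : (forall t, t \in `[a, b] -> `|t| <= `|h|) ->
    {within `[a, b], continuous g}.
  move=> ab; apply: derivable_within_continuous => t /ab /dg[+ _].
  by [].
have g0 : g 0 = f p by rewrite /g scale0r addr0.
have [hpos|hneg|/esym h00] := ltgtP 0 h; last by rewrite h00 eqxx in h0.
- have ab t : t \in `[0, h] -> `|t| <= `|h|.
    by rewrite in_itv /= => /andP[t0 th]; rewrite !ger0_norm // (le_trans t0).
  have [t tab gE] := MVT hpos (fun t tab => dg t (ab t (subset_itv_oo_cc tab)))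
    (cg _ _ ab).
  exists t; first exact/ab/subset_itv_oo_cc.
  by rewrite -g0 -/(g h) gE subr0 mulfK.
- have ab t : t \in `[h, 0] -> `|t| <= `|h|.
    rewrite in_itv /= => /andP[th t0].
    by rewrite !ler0_norm ?lerN2 // (le_trans th).
  have [t tab gE] := MVT hneg (fun t tab => dg t (ab t (subset_itv_oo_cc tab)))
    (cg _ _ ab).
  exists t; first exact/ab/subset_itv_oo_cc.
  by rewrite -g0 -/(g h) -[g h - _]opprB gE sub0r mulrN opprK mulfK.
Qed.

(** Telescoping along the coordinate directions from [x] to [y] writes
[f y - f x] as a sum of difference quotients times [y_j - x_j]; by the mean
value theorem each quotient is a value of a partial derivative at a point no
further from [x] than [y], which gives its continuity at [x].  This form of
differentiability makes the chain rule a computation of limits. *)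
Lemma caratheodory n (f : 'rV[R]_n -> R) (U : set 'rV[R]_n) (x : 'rV[R]_n) :
  open U -> U x -> Ck 1 U f -> exists q : 'I_n -> 'rV[R]_n -> R,
    [/\ (forall y, f y - f x = \sum_j (y 0 j - x 0 j) * q j y),
        (forall j, q j x = 'D_(delta_mx 0 j) f x) &
        (forall j, {for x, continuous (q j)})].
Proof.
move=> oU Ux [_ df].
(* The first [j] coordinates are those of [y], the others those of [x]. *)
pose mix (j : nat) (y : 'rV[R]_n) : 'rV[R]_n :=
  \row_i (if (i < j)%N then y 0 i else x 0 i).
have mixS (j : 'I_n) y :
    mix j.+1 y = mix j y + (y 0 j - x 0 j) *: delta_mx 0 j.
  apply/rowP => i; rewrite !mxE eqxx /= ltnS; case: (ltngtP i j) => ij.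
  - by rewrite (ltn_eqF ij : i == j = false) mulr0 addr0.
  - by rewrite (gtn_eqF ij : i == j = false) mulr0 addr0.
  - by rewrite (val_inj ij) eqxx mulr1 addrC subrK.
pose q (j : 'I_n) (y : 'rV[R]_n) := if y 0 j == x 0 j then 'D_(delta_mx 0 j) f x
  else (f (mix j.+1 y) - f (mix j y)) / (y 0 j - x 0 j).
exists q; split.
- move=> y.
  have -> : f y - f x = f (mix n y) - f (mix 0%N y).
    by congr (f _ - f _); apply/rowP => i; rewrite mxE ?ltn_ord.
  rewrite -(telescope_sumr (fun j => f (mix j y))) // big_mkord.
  apply: eq_bigr => j _; rewrite /q; case: eqVneq => [e|ne].
    by rewrite mixS e subrr scale0r addr0 subrr mul0r.
  by rewrite mulrCA divff ?mulr1 // subr_eq0.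
- by move=> j; rewrite /q eqxx.
move=> j; have [dfj [cdfj _]] := df j.
rewrite /prop_for /continuous_at; apply/(@cvgrPdist_lt _ R^o _ (nbhs x) (nbhs_filter x)) => e e0; rewrite /q eqxx.
have /nbhs_ballP[d /= d0 bd] : nbhs x (U `&` [set z |
    `|'D_(delta_mx 0 j) f x - 'D_(delta_mx 0 j) f z| < e]).
  apply: filterI; first exact: open_nbhs_nbhs.
  by have /cvgrPdist_lt/(_ e e0) := cdfj x Ux.
apply/nbhs_ballP; exists d => //= y xy; case: eqVneq => [_|ne].
  by rewrite subrr normr0.
have inb t : `|t| <= `|y 0 j - x 0 j| ->
    ball x d (mix j y + t *: delta_mx 0 j).
  move=> ty; case: xy => _ xy; split=> // a i; rewrite !ord1 !mxE eqxx /=.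
  have := xy 0 i; rewrite /ball /=; case: (ltngtP i j) => ij.
  - by rewrite (ltn_eqF ij : i == j = false) mulr0 addr0.
  - by rewrite (gtn_eqF ij : i == j = false) mulr0 addr0 subrr normr0.
  - rewrite (val_inj ij) eqxx mulr1 opprD addrA subrr sub0r normrN => xyj.
    by apply: le_lt_trans ty _; rewrite distrC.
rewrite mixS; have [|t ty ->] := @MVT_line _ f (mix j y) (delta_mx 0 j) (y 0 j - x 0 j) _
    (fun t ty => dfj _ (bd _ (inb t ty)).1).
  by rewrite subr_eq0.
by have [_] := bd _ (inb t ty).
Qed.

Lemma derivable_cvg (V : normedModType R) (g : V -> R) (x v : V) :
  derivable g x v -> g (h *: v + x) @[h --> (0 : R)^'] --> g x.
Proof.
move=> dg.
have E : forall h : R, h != 0 ->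
    g (h *: v + x) = h * (h^-1 * (g (h *: v + x) - g x)) + g x.
  by move=> h h0; rewrite mulrA divff // mul1r subrK.
have : (fun h : R => h * (h^-1 * (g (h *: v + x) - g x)) + g x) @ (0 : R)^'
     --> 0 * 'D_v g x + g x.
  apply: cvgD; last exact: cvg_cst.
  apply: cvgM; last exact: dg.
  by apply: cvg_within_filter; exact: cvg_id.
rewrite mul0r add0r; apply: cvg_trans; apply: near_eq_cvg.
by have := nbhs_dnbhs_neq (0 : R); apply: filterS => h h0; rewrite -E.
Qed.

Lemma cvg_sumr (T : Type) (F : set_system T) (FF : Filter F) (I : Type)
    (s : seq I) (f : I -> T -> R) (l : I -> R) :
  (forall i, f i @ F --> l i) ->
  (fun t => \sum_(i <- s) f i t) @ F --> \sum_(i <- s) l i.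
Proof.
move=> fl; elim: s => [|i s IH].
  rewrite big_nil; under eq_fun do rewrite big_nil; exact: cvg_cst.
rewrite big_cons; under eq_fun do rewrite big_cons.
exact: cvgD.
Qed.

Lemma chain_rule n (V : normedModType R) (f : 'rV[R]_n -> R)
    (U : set 'rV[R]_n) (phi : V -> 'rV[R]_n) (x v : V) :
  open U -> U (phi x) -> Ck 1 U f ->
  (forall j, derivable (fun y => phi y 0 j) x v) ->
  is_derive x v (f \o phi)
    (\sum_j 'D_(delta_mx 0 j) f (phi x) * 'D_v (fun y => phi y 0 j) x).
Proof.
move=> oU Ux Cf dphi; have [q [fE qx cq]] := caratheodory oU Ux Cf.
have cphi : phi (h *: v + x) @[h --> (0 : R)^'] --> phi x.
  apply/cvg_ballP => e e0.
  have : \forall h \near (0 : R)^', forall j, ball (phi x 0 j) e (phi (h *: v + x) 0 j).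
    apply: filter_forall => j.
    by have /cvg_ballP/(_ e e0) := derivable_cvg (dphi j).
  by apply: filterS => h H; split=> // i j; rewrite !ord1; exact: H.
have H : (fun h : R => h^-1 *: (((f \o phi) \o shift x) (h *: v) - (f \o phi) x))
    @ (0 : R)^' -->
    \sum_j 'D_v (fun y => phi y 0 j) x * 'D_(delta_mx 0 j) f (phi x).
  have -> : (fun h : R => h^-1 *: (((f \o phi) \o shift x) (h *: v) - (f \o phi) x)) =
    fun h : R => \sum_j (h^-1 *: (phi (h *: v + x) 0 j - phi x 0 j)) *
        q j (phi (h *: v + x)).
    apply/funext => h /=; rewrite fE scaler_sumr; apply: eq_bigr => j _.
    by rewrite scalerAl.
  apply: cvg_sumr => j; apply: cvgM; first exact: dphi.
  by rewrite -qx; apply: cvg_comp cphi _; exact: cq.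
have -> : \sum_j 'D_(delta_mx 0 j) f (phi x) * 'D_v (fun y => phi y 0 j) x =
  \sum_j 'D_v (fun y => phi y 0 j) x * 'D_(delta_mx 0 j) f (phi x).
  by apply: eq_bigr => j _; rewrite mulrC.
apply: DeriveDef; last exact: cvg_lim H.
by apply/cvg_ex; eexists; exact: H.
Qed.
End Calculus.

Section CkCalculus.
Variable R : realType.

(** Every clause of [Ck] speaks of one point at a time. *)
Lemma Ck_pointwise n k (U : set 'rV[R]_n) f :
  (forall x, U x -> Ck k [set x] f) -> Ck k U f.
Proof.
elim: k f => [|k IH] f H.
  by split=> // x Ux; have [cf _] := H x Ux; exact: cf.
split=> [x Ux|i]; first by have [cf _] := H x Ux; exact: cf.
split=> [x Ux|]; first by have [_ /(_ i)[df _]] := H x Ux; exact: df.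
by apply: IH => x Ux; have [_ /(_ i)[_ ?]] := H x Ux.
Qed.

Lemma Ck_local n k (U : set 'rV[R]_n) f :
  (forall x, U x -> exists V g, [/\ open V, V x, Ck k V g &
     forall y, V y -> g y = f y]) -> Ck k U f.
Proof.
move=> H; apply: Ck_pointwise => x Ux; have [V [g [oV Vx Cg gf]]] := H x Ux.
by apply: Ck_sub (Ck_eq oV gf Cg) => y ->.
Qed.

Lemma Ck_sum n k (U : set 'rV[R]_n) (I : Type) (s : seq I)
    (f : I -> 'rV[R]_n -> R) : open U -> (forall i, Ck k U (f i)) ->
  Ck k U (fun x => \sum_(i <- s) f i x).
Proof.
move=> oU Cf; elim: s => [|i s IH].
  by under eq_fun do rewrite big_nil; exact: Ck_cst.
by under eq_fun do rewrite big_cons; exact: Ck_add.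
Qed.

Lemma is_derive_coord n (i j : 'I_n) (x : 'rV[R]_n) :
  is_derive x (delta_mx 0 i) (fun x : 'rV[R]_n => x 0 j) ((i == j)%:R : R).
Proof.
have H : (fun h : R => h^-1 *: (((fun x : 'rV[R]_n => x 0 j) \o shift x)
    (h *: delta_mx 0 i) - x 0 j)) @ (0 : R)^' --> ((i == j)%:R : R).
  apply: cvg_near_cst; have := nbhs_dnbhs_neq (0 : R).
  apply: filterS => h h0 /=.
  by rewrite !mxE eqxx /= addrK [h^-1 *: _]mulrA mulVf // mul1r eq_sym.
by split; [apply/cvg_ex; eexists; exact: H | exact: cvg_lim H].
Qed.

Lemma Ck_coord n k (U : set 'rV[R]_n) j : Ck k U (fun x : 'rV[R]_n => x 0 j).
Proof.
case: k => [|k].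
all: split=> [x _|]; first exact: coord_continuous.
- by [].
move=> i; split=> [x _|]; first by have [] := is_derive_coord i j x.
rewrite (_ : (fun _ => _) = fun=> (i == j)%:R); first exact: Ck_cst.
by apply/funext => x; have [] := is_derive_coord i j x.
Qed.

Lemma continuous_row (T : topologicalType) n (phi : T -> 'rV[R]_n) (x : T) :
  (forall j, {for x, continuous (fun y => phi y 0 j)}) ->
  {for x, continuous phi}.
Proof.
move=> cphi; rewrite /prop_for /continuous_at; apply/cvg_ballP => e e0.
have : \forall y \near x, forall j, ball (phi x 0 j) e (phi y 0 j).
  by apply: filter_forall => j; have /cvg_ballP/(_ e e0) := cphi j.
by apply: filterS => y H; split=> // i j; rewrite !ord1; exact: H.
Qed.

(** The partial derivatives of the composite are given by the chain rule in terms
of functions of class [C^k], hence induction on [k]. *)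
Lemma Ck_comp m n k (U : set 'rV[R]_m) (V : set 'rV[R]_n)
    (phi : 'rV[R]_m -> 'rV[R]_n) (f : 'rV[R]_n -> R) :
  open U -> open V -> (forall x, U x -> V (phi x)) ->
  (forall j, Ck k U (fun x => phi x 0 j)) -> Ck k V f -> Ck k U (f \o phi).
Proof.
move=> oU oV UV; elim: k f => [|k IH] f Cphi Cf.
all: have cphi x : U x -> {for x, continuous phi}
  by move=> Ux; apply: continuous_row => j; have [+ _] := Cphi j; exact.
all: have [cf df] := Cf.
all: split; first by move=> x Ux; apply: continuous_comp; [exact: cphi|exact/cf/UV].
- by [].
have C1 : Ck 1 V f.
  split=> // i; split; first by have [] := df i.
  by split=> //; have [_] := df i; case: (k) => [|?] [].
have D x i : U x -> is_derive x (delta_mx 0 i) (f \o phi)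
    (\sum_j 'D_(delta_mx 0 j) f (phi x) * 'D_(delta_mx 0 i) (fun y => phi y 0 j) x).
  move=> Ux; apply: (chain_rule oV (UV x Ux) C1) => j.
  by have [_ /(_ i)[+ _]] := Cphi j; exact.
move=> i; split=> [x Ux|]; first by have [] := D x i Ux.
have : Ck k U (fun x => \sum_j ('D_(delta_mx 0 j) f \o phi) x *
    'D_(delta_mx 0 i) (fun y => phi y 0 j) x).
  apply: Ck_sum => // j; apply: Ck_mul => //; last first.
    by have [_ /(_ i)[_ +]] := Cphi j.
  by apply: IH => [j'|]; [exact/Ck_le/Cphi | have [_] := df j].
by apply: Ck_eq => // x Ux; have [_ ->] := D x i Ux.
Qed.

Lemma Ck_inv n k (U : set 'rV[R]_n) f : open U -> (forall x, U x -> f x != 0) ->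
  Ck k U f -> Ck k U (fun x => (f x)^-1).
Proof.
move=> oU f0; elim: k => [|k IH] Cf; have [cf df] := Cf.
all: split; first by move=> x Ux; apply: continuousV; [exact: f0|exact: cf].
- by [].
move=> i; have [dfi cdf] := df i; split=> [x Ux|].
  by apply: derivableV; [exact: f0|exact: dfi].
have CV := IH (Ck_le Cf).
apply: (Ck_eq oU) (Ck_mul oU (@Ck_cst R n k U (-1))
  (Ck_mul oU (Ck_mul oU CV CV) cdf)) => x Ux.
by rewrite deriveV ?f0 //; [rewrite mulN1r -invfM -expr2 -mulNr | exact: dfi].
Qed.

End CkCalculus.

(** * Plateau functions *)

Section Flat.
Variable R : realType.

(** The functions [t ^ (- j) exp (- 1 / t)], extended by [0] to [t <= 0]: the
derivative of each is a combination of the next two. *)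
Definition flat (j : nat) (t : R) : R :=
  if 0 < t then t^-1 ^+ j * expR (- t^-1) else 0.

Lemma flat_gt0 j t : 0 < t -> 0 < flat j t.
Proof.
by move=> t0; rewrite /flat t0 mulr_gt0 ?expR_gt0 // exprn_gt0 ?invr_gt0.
Qed.

Lemma flat_ge0 j t : 0 <= flat j t.
Proof.
by have [/(flat_gt0 j)/ltW|] := boolP (0 < t) => //; rewrite /flat => /negbTE->.
Qed.

Lemma flat_le0 j t : t <= 0 -> flat j t = 0.
Proof. by rewrite /flat ltNge => ->. Qed.


(** The bound [s ^ (j + 1) <= (j + 1)! exp s] at [s = 1 / t]; it gives the
derivative [0] of [flat j] at [0], where the difference quotient of [flat j] is
[flat j.+1]. *)
Lemma flat_lin j t : `|flat j t| <= j.+1`!%:R * `|t|.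
Proof.
rewrite ger0_norm ?flat_ge0 //; have [t0|t0] := ltP 0 t; last first.
  by rewrite flat_le0 // mulr_ge0.
rewrite /flat t0 expRN ler_pdivrMr ?expR_gt0 // (gtr0_norm t0) mulrAC.
rewrite -ler_pdivrMr // -exprSr.
have := @expR_ge1Dxn R t^-1 j (ltW (_ : 0 < t^-1)).
rewrite invr_gt0 => /(_ t0); rewrite addrC -lerBrDr => H.
rewrite mulrC -ler_pdivrMr ?ltr0n ?fact_gt0 //.
by apply: le_trans H _; rewrite lerBlDr lerDl.
Qed.

Lemma flat_derive j t :
  is_derive t (1 : R) (flat j) (- j%:R * flat j.+1 t + flat j.+2 t).
Proof.
have [t0|t0|t0] := ltgtP 0 t.
- pose g := (fun s : R => s^-1 ^+ j * expR (- s^-1)).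
  have dg : is_derive t (1 : R) g (- j%:R * flat j.+1 t + flat j.+2 t).
    have dV : is_derive t (1 : R) (fun s : R => s^-1) (- t^-1 ^+ 2).
      apply: is_derive_eq.
        by apply: is_deriveV; exact: lt0r_neq0.
      by rewrite [_ *: _]mulr1 -exprVn.
    have dE : is_derive t (1 : R) (fun s : R => expR (- s^-1))
        (expR (- t^-1) * t^-1 ^+ 2).
      have := @is_derive1_comp R expR (fun s => - s^-1) t _ _
        (is_derive_expR _) (is_deriveN dV).
      by rewrite opprK.
    have H := is_deriveM (is_deriveX j dV) dE.
    apply: is_derive_eq.
      apply: near_eq_is_derive H.
      by apply: filterE => s; rewrite /g !fctE.
    rewrite /flat t0 -![_ *: _]/(_ * _) fctE.
    clear; case: j => [|j]; first by rewrite !mul0r oppr0 mul0r !expr0; ring.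
    by rewrite /= !exprS; ring.
  apply: near_eq_is_derive dg.
  by have := lt_nbhsr t0; apply: filterS => s s0; rewrite /flat s0.
- rewrite !(flat_le0 _ (ltW t0)) mulr0 addr0.
  apply: near_eq_is_derive (is_derive_cst (0 : R) t (1 : R)).
  by have := lt_nbhsl t0; apply: filterS => s s0; rewrite flat_le0 // ltW.
- rewrite -t0 !flat_le0 // mulr0 addr0.
  have H : (fun h : R => h^-1 *: ((flat j \o shift 0) (h *: 1) - flat j 0))
      @ (0 : R)^' --> (0 : R).
    apply: (@cvg_to_0_linear R _ j.+2`!%:R 1) => // h /andP[h0 _].
    have -> : h^-1 *: ((flat j \o shift 0) (h *: 1) - flat j 0) = flat j.+1 h.
      rewrite (flat_le0 _ (lexx 0)) subr0 /= addr0 [h *: 1]mulr1.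
      rewrite /flat; case: ifP => _; last by rewrite scaler0.
      by rewrite exprS -mulrA.
    exact: flat_lin.
  split; [apply/cvg_ex; eexists; exact: H | exact: cvg_lim H].
Qed.


(** The induction on [k] treats all the functions [flat j] at once. *)
Lemma Ck_flat n k (U : set 'rV[R]_n) (g : 'rV[R]_n -> R) j :
  open U -> Ck k U g -> Ck k U (fun x => flat j (g x)).
Proof.
move=> oU Cg; pose phi x : 'rV[R]_1 := \row_(_ < 1) g x.
suff Cf : Ck k setT (fun y : 'rV[R]_1 => flat j (y 0 0)).
  have := @Ck_comp _ _ _ _ U setT phi _ oU openT (fun _ _ => I) _ Cf.
  rewrite [X in Ck _ _ X](_ : _ = (fun x => flat j (g x))); last first.
    by apply/funext => x; rewrite /= mxE.
  apply=> i; rewrite [X in Ck _ _ X](_ : _ = g) //.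
  by apply/funext => x; rewrite mxE.
have D i j' (y : 'rV[R]_1) : is_derive y (delta_mx 0 i)
    (fun y : 'rV[R]_1 => flat j' (y 0 0))
    (- j'%:R * flat j'.+1 (y 0 0) + flat j'.+2 (y 0 0)).
  have [] := flat_derive j' (y 0 0); rewrite /derivable /derive.
  set G := (fun h : R => _).
  rewrite (_ : G = fun h : R => h^-1 *: (((fun y : 'rV[R]_1 => flat j' (y 0 0))
    \o shift y) (h *: delta_mx 0 i) - flat j' (y 0 0))).
    by move=> c e; split.
  apply/funext => h; congr (_ *: (flat _ _ - _)).
  by rewrite /= !mxE !ord1 eqxx.
elim: k j {Cg} => [|k IH] j.
all: split=> [y _|]; first by (apply: continuous_comp; [exact: coord_continuous|];
  apply: differentiable_continuous; apply/derivable1_diffP;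
  have [] := flat_derive j (y 0 0)).
- by [].
move=> i; split=> [y _|]; first by have [] := D i j y.
rewrite [X in Ck _ _ X](_ : _ = (fun y : 'rV[R]_1 =>
    - j%:R * flat j.+1 (y 0 0) + flat j.+2 (y 0 0))).
  by apply: Ck_add; [exact: openT| |exact: IH];
    apply: Ck_mul; [exact: openT|exact: Ck_cst|exact: IH].
by apply/funext => y; have [_ ->] := D i j y.
Qed.

(** The plateau is the quotient [h (b - s) / (h (b - s) + h (s - a))], where
[h] is flat at [0], [s] is the squared Euclidean distance to [c], and the
numbers [a < b] are small. *)
Lemma plateau n (c : 'rV[R]_n) (W : set 'rV[R]_n) : open W -> W c ->
  exists (psi : 'rV[R]_n -> R) (d e : R), [/\ 0 < e, smooth_on setT psi,
    (forall x : 'rV[R]_n, (forall i, x 0 i \in `[c 0 i - d, c 0 i + d]) -> W x),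
    (forall x : 'rV[R]_n, ~ (forall i, x 0 i \in `[c 0 i - d, c 0 i + d]) -> psi x = 0) &
    (forall x, ball c e x -> psi x = 1)].
Proof.
move=> oW Wc; have /nbhs_ballP[d /= d0 dW] := open_nbhs_nbhs (conj oW Wc).
(* With half the radius, the closed box around [c] lies in the ball, and it
   contains the points with [s <= b]. *)
pose b : R := (d / 2) ^+ 2; pose a : R := b / 2.
have b0 : 0 < b by rewrite exprn_gt0 // divr_gt0.
have a0 : 0 < a by rewrite divr_gt0.
have ab : a < b by rewrite /a ltr_pdivrMr // ltr_pMr // ltrDl.
pose s (x : 'rV[R]_n) : R := \sum_i (x 0 i - c 0 i) * (x 0 i - c 0 i).
have Cs k : Ck k setT s.
  apply: Ck_sum => [|i]; first exact: openT.
  have C : Ck k setT (fun x : 'rV[R]_n => x 0 i - c 0 i).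
    by apply: Ck_add; [exact: openT|exact: Ck_coord|exact: Ck_cst].
  by apply: Ck_mul => //; exact: openT.
have Cflat k (u v : R) : Ck k setT (fun x => flat 0 (u + v * s x)).
  apply: Ck_flat; first exact: openT.
  apply: Ck_add; [exact: openT|exact: Ck_cst|].
  by apply: Ck_mul; [exact: openT|exact: Ck_cst|exact: Cs].
pose num x := flat 0 (b + (-1) * s x); pose den x := num x + flat 0 (- a + 1 * s x).
have den0 x : den x != 0.
  apply: lt0r_neq0; rewrite /den /num; have [sx|sx] := ltP (s x) b.
    by rewrite ltr_wpDr ?flat_ge0 // flat_gt0 // mulN1r subr_gt0.
  by rewrite ltr_wpDl ?flat_ge0 // flat_gt0 // mul1r addrC subr_gt0 (lt_le_trans ab).
have : \forall x \near c, s x < a.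
  have [cs _] := Cs 0%N; have := cs c I; rewrite /prop_for /continuous_at.
  have -> : s c = 0 by rewrite /s big1 // => i _; rewrite subrr mul0r.
  move/(@cvgr0_norm_lt _ R^o _ _ (nbhs_filter c)) => /(_ a a0);
    by apply: filterS => x; exact: le_lt_trans (ler_norm _).
move=> /nbhs_ballP[e /= e0 ea].
exists (fun x => num x * (den x)^-1), (d / 2), e; split=> //.
- move=> k; apply: Ck_mul; [exact: openT|exact: Cflat|].
  apply: Ck_inv; [exact: openT|by []|].
  by apply: Ck_add; [exact: openT|exact: Cflat|exact: Cflat].
- move=> x xc; apply: dW; split=> // i j; rewrite !ord1 /ball /= distrC.
  have := xc j; rewrite in_itv /= -ler_distl => H; apply: le_lt_trans H _.
  by rewrite ltr_pdivrMr // ltr_pMr // ltr1n.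
- move=> x /existsNP[i /negP xi]; rewrite /num flat_le0 ?mul0r //.
  rewrite mulN1r subr_le0 /s (bigD1 i) //= ler_wpDr ?sumr_ge0 // => [j _|].
    by rewrite -expr2 sqr_ge0.
  move: xi; rewrite in_itv /= -ler_distl -ltNge => /ltW xi.
  rewrite -expr2 -[leRHS]ger0_norm ?sqr_ge0 // normrX.
  by rewrite ler_pXn2r // nnegrE ltW // divr_gt0.
- move=> x /ea /= sx; rewrite /den (flat_le0 0 (_ : - a + 1 * s x <= 0)).
    by rewrite addr0 divff // /num gt_eqF // flat_gt0 // mulN1r subr_gt0 (lt_trans sx).
  by rewrite mul1r addrC subr_le0 ltW.
Qed.

End Flat.

(** * Smooth functions and bump functions *)

Section SmoothFunctions.
Variables (R : realType) (n : nat) (M : manifold R n).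
Implicit Types (U V W : set M) (f g : M -> R).

Lemma smooth_fun_local U f :
  (forall m, U m -> exists V g, [/\ open V, V m, smooth_fun V g &
     forall p, V p -> g p = f p]) -> smooth_fun U f.
Proof.
move=> H a k; apply: Ck_local => _ [m [Um am] <-].
have [V [g [oV Vm sg gf]]] := H m Um.
exists (cmap a @` (V `&` cdom a)), (g \o @cinv R n M a); split.
- exact: chart_open.
- by exists m.
- exact: sg.
- by move=> _ [p [Vp ap] <-] /=; rewrite cmapK // gf.
Qed.

Lemma smooth_fun_sub U V f : U `<=` V -> smooth_fun V f -> smooth_fun U f.
Proof.
move=> UV sf a k; apply: Ck_sub (sf a k) => _ [m [Um am] <-].
by exists m => //; split=> //; exact: UV.
Qed.

Lemma smooth_fun_eq U f g : open U -> (forall p, U p -> f p = g p) ->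
  smooth_fun U f -> smooth_fun U g.
Proof. by move=> oU fg sf; apply: smooth_fun_local => m Um; exists U, f. Qed.

Lemma smooth_fun_sum U (I : Type) (s : seq I) (P : pred I) (f : I -> M -> R) :
  open U -> (forall i, smooth_fun U (f i)) ->
  smooth_fun U (fun m => \sum_(i <- s | P i) f i m).
Proof.
move=> oU sf; elim: s => [|i s IH].
  by under eq_fun do rewrite big_nil; exact: smooth_fun_cst.
under eq_fun do rewrite big_cons.
by case: (P i) => //; exact: smooth_fun_add.
Qed.

Lemma smooth_fun_prod U (I : Type) (s : seq I) (P : pred I) (f : I -> M -> R) :
  open U -> (forall i, smooth_fun U (f i)) ->
  smooth_fun U (fun m => \prod_(i <- s | P i) f i m).
Proof.
move=> oU sf; elim: s => [|i s IH].
  by under eq_fun do rewrite big_nil; exact: smooth_fun_cst.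
under eq_fun do rewrite big_cons.
by case: (P i) => //; exact: smooth_fun_mul.
Qed.

(** Smoothness is read in a single chart, because the change to any other
chart is smooth. *)
Lemma smooth_fun_chart (a : cidx M) U f : open U -> U `<=` cdom a ->
  smooth_on (cmap a @` U) (f \o @cinv R n M a) -> smooth_fun U f.
Proof.
move=> oU Ua sf b k.
have oUa : open (cmap a @` U).
  by have /setIidPl <- := Ua; exact: chart_open.
apply: (Ck_eq (f := (f \o @cinv R n M a) \o (@cmap R n M a \o @cinv R n M b))).
- exact: chart_open.
- by move=> _ [p [Up bp] <-] /=; rewrite !cmapK //; exact: Ua.
apply: (@Ck_comp _ _ _ _ _ (cmap a @` U)) => //; first exact: chart_open.
- by move=> _ [p [Up bp] <-] /=; rewrite cmapK //; exists p.
- move=> j; apply: Ck_sub (@transition_smooth R n M b a j k) => _ [p [Up bp] <-].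
  by exists p => //; split=> //; exact: Ua.
Qed.

Lemma chart_coord_smooth (a : cidx M) i :
  smooth_fun (cdom a) (fun m => cmap a m 0 i).
Proof.
apply: (@smooth_fun_chart a) => //; first exact: cdom_open.
move=> k; apply: Ck_eq (Ck_coord k (cmap a @` cdom a) i); first exact: cim_open.
by move=> _ [p ap <-] /=; rewrite cmapK.
Qed.

(** Extending a plateau of a chart by zero gives a smooth function, because the
image of its compact support is closed in a Hausdorff space. *)
Lemma bump_function (m0 : M) U : open U -> U m0 ->
  exists (psi : Cinf M) V W, [/\ open V /\ open W, V m0 /\ V `<=` U,
    (forall m, U m \/ W m), (forall m, V m -> psi m = 1) &
    (forall m, W m -> psi m = 0)].
Proof.
move=> oU Um0; have [a am0] := cdom_cover m0.
have [|psi0 [d [e [e0 spsi Kin psi_out psi1]]]] :=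
  plateau (chart_open (a := a) oU) (_ : (cmap a @` (U `&` cdom a)) (cmap a m0)).
  by exists m0.
pose box : set 'rV[R]_n :=
  [set x | forall i, x 0 i \in `[cmap a m0 0 i - d, cmap a m0 0 i + d]].
pose K := cinv a @` box.
have cK : compact K.
  apply: continuous_compact; last first.
    by apply: (@rV_compact R n
      (fun i => `[cmap a m0 0 i - d, cmap a m0 0 i + d]%classic)) => i;
      exact: segment_compact.
  apply: continuous_in_subspaceT => x /set_mem bx; apply: cinv_continuous.
  have [p [_ ap] <-] := Kin x bx; by exists p.
have KU : K `<=` U `&` cdom a.
  by move=> _ [x bx <-]; have [p [Up ap] <-] := Kin x bx; rewrite cmapK.
pose W : set M := ~` K.
have oW : open W by apply: closed_openC; exact: compact_closed (@m_hausdorff _ _ M) cK.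
pose f (m : M) : R := if `[< cdom a m >] then psi0 (cmap a m) else 0.
have fW m : W m -> f m = 0.
  rewrite /f; case: asboolP => // am Wm; apply: psi_out => bm; apply: Wm.
  by exists (cmap a m) => //; exact: cmapK.
have sf : smooth_fun setT f.
  apply: smooth_fun_local => m _; have [am|nam] := pselect (cdom a m).
    exists (cdom a), (psi0 \o cmap a); split=> //; first exact: cdom_open.
      apply: (@smooth_fun_chart a) => //; first exact: cdom_open.
      move=> k; apply: (Ck_eq (f := psi0)); first exact: cim_open.
        by move=> _ [p ap <-] /=; rewrite cmapK.
      exact: Ck_sub (spsi k).
    by move=> p ap; rewrite /f asboolT.
  exists W, (fun=> 0); split=> //; first by move=> /KU[].
    exact: smooth_fun_cst.
  by move=> p Wp; rewrite fW.
pose V := interior (U `&` [set m | f m = 1]).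
exists (CInf sf), V, W; split=> //.
- by split=> //; exact: open_interior.
- split; last by move=> m /interior_subset[].
  apply: filterI; first exact: open_nbhs_nbhs.
  have na : nbhs m0 (cdom a) by apply: open_nbhs_nbhs; split=> //; exact: cdom_open.
  have nb : nbhs m0 (cmap a @^-1` ball (cmap a m0) e).
    by apply: (cmap_continuous am0); exact: nbhsx_ballx.
  by apply: filterS2 na nb => m am bm; rewrite /= /f asboolT // psi1.
- move=> m; have [Km|nKm] := pselect (K m); last by right.
  by left; have [] := KU m Km.
- by move=> m /interior_subset[].
Qed.

Lemma smooth_fun_bump U W (psi : Cinf M) f : open U -> open W ->
  (forall m, U m \/ W m) -> (forall m, W m -> psi m = 0) ->
  smooth_fun U f -> smooth_fun setT (fun m => psi m * f m).
Proof.
move=> oU oW UW psi0 sf; apply: smooth_fun_local => m _.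
have [Um|Wm] := UW m; last first.
  by exists W, (fun=> 0); split=> //; [exact: smooth_fun_cst|
    move=> p Wp; rewrite psi0 // mul0r].
exists U, (fun m => psi m * f m); split=> //; apply: smooth_fun_mul => //.
by apply: smooth_fun_sub (cvalP psi).
Qed.

End SmoothFunctions.

(** * Tangent vectors and coordinate fields *)

Section TangentVectors.
Variables (R : realType) (n : nat) (M : manifold R n).
Implicit Types (U V W : set M) (f g h : Cinf M).

Lemma derivable_chart f (a : cidx M) m i : cdom a m ->
  derivable (f \o @cinv R n M a) (cmap a m) (delta_mx 0 i).
Proof. by move=> am; have [_ /(_ i)[+ _]] := cvalP f a 1%N; apply; exists m. Qed.

Lemma near_chart (a : cidx M) m V : open V -> V m -> cdom a m ->
  \forall x \near cmap a m, V (cinv a x) /\ (cmap a @` cdom a) x.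
Proof.
move=> oV Vm am.
have ix : (cmap a @` cdom a) (cmap a m) by exists m.
apply: filterI; last exact: open_nbhs_nbhs (conj (cim_open M a) ix).
by apply: (cinv_continuous ix); rewrite cmapK //; exact: open_nbhs_nbhs.
Qed.

Lemma partial_local (a : cidx M) i (u w : M -> R) m V : open V -> V m -> cdom a m ->
  (forall p, V p -> u p = w p) -> partial a i u m = partial a i w m.
Proof.
move=> oV Vm am fg; apply: near_eq_derive.
by apply: filterS (near_chart oV Vm am) => x [Vx _] /=; exact: fg.
Qed.

Lemma tangentE m (v : tangent m) : exists2 a, cdom a m &
  exists c, forall f, tangent_app v f = \sum_i c i * partial a i f m.
Proof.
have [a am] := cdom_cover m; exists a => //.
by have /asboolP/(_ a am) := sp_valP v.
Qed.

Lemma tangent_local m (v : tangent m) f g V : open V -> V m ->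
  (forall p, V p -> f p = g p) -> tangent_app v f = tangent_app v g.
Proof.
move=> oV Vm fg; have [a am [c vE]] := tangentE v; rewrite !vE.
by apply: eq_bigr => i _; rewrite (partial_local i oV Vm am fg).
Qed.

Lemma tangent_leibniz m (v : tangent m) f g h : (forall p, h p = f p * g p) ->
  tangent_app v h = f m * tangent_app v g + g m * tangent_app v f.
Proof.
move=> hE; have [a am [c vE]] := tangentE v; rewrite !vE !mulr_sumr -big_split /=.
apply: eq_bigr => i _; rewrite mulrCA [g m * _]mulrCA -mulrDr; congr (_ * _).
rewrite /partial (_ : (h \o _) =
  (f \o @cinv R n M a) * (g \o @cinv R n M a)); last first.
  by apply/funext => x; exact: hE.
by rewrite deriveM; [rewrite /= cmapK | exact: derivable_chart..].
Qed.

Lemma tangent_cst m (v : tangent m) f V (c : R) : open V -> V m ->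
  (forall p, V p -> f p = c) -> tangent_app v f = 0.
Proof.
move=> oV Vm fc; have [a am [d vE]] := tangentE v; rewrite vE big1 // => i _.
rewrite (partial_local i (w := fun=> c) oV Vm am fc) /partial.
by rewrite (_ : _ \o _ = fun=> c) // (@derive_cst R _ R^o) mulr0.
Qed.

Lemma tangent_ext m (v w : tangent m) :
  (forall f, tangent_app v f = tangent_app w f) -> v = w.
Proof. by move=> H; apply/val_inj/funext. Qed.

Lemma tangent_app_sum m (I : finType) (c : I -> R) (X : I -> tangent m) f :
  tangent_app (\sum_i c i *: X i) f = \sum_i c i * tangent_app (X i) f.
Proof.
elim: (index_enum I) => [|i s IH]; first by rewrite !big_nil.
by rewrite !big_cons -IH.
Qed.

(** By the chain rule for the transition map, a partial derivative in one chart
is a combination of the partial derivatives in any other. *)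
Lemma partial_tangent (a : cidx M) i m : cdom a m ->
  tangent_set m (fun f => partial a i f m).
Proof.
move=> am b bm; pose phi := @cmap R n M b \o @cinv R n M a.
exists (fun j => 'D_(delta_mx 0 i) (fun x => phi x 0 j) (cmap a m)) => f.
have phim : phi (cmap a m) = cmap b m by rewrite /phi /= cmapK.
have D : is_derive (cmap a m) (delta_mx 0 i : 'rV[R]_n)
    ((f \o @cinv R n M b) \o phi)
    (\sum_j 'D_(delta_mx 0 j) (f \o @cinv R n M b) (phi (cmap a m)) *
            'D_(delta_mx 0 i) (fun x => phi x 0 j) (cmap a m)).
  apply: (@chain_rule _ _ _ _ (cmap b @` (setT `&` cdom b))).
  - exact/chart_open/openT.
  - by rewrite phim; exists m.
  - exact: cvalP.
  - move=> j; have [_ /(_ i)[+ _]] := @transition_smooth R n M a b j 1%N.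
    by apply; exists m.
rewrite /partial (near_eq_derive (g := (f \o @cinv R n M b) \o phi)).
  by have [_ ->] := D; apply: eq_bigr => j _; rewrite phim mulrC.
apply: filterS (near_chart (cdom_open M b) bm am) => x [bx _].
by rewrite /phi /= cmapK.
Qed.

Lemma partial_smooth (a : cidx M) i f : smooth_fun (cdom a) (partial a i f).
Proof.
apply: (@smooth_fun_chart _ _ _ a) => //; first exact: cdom_open.
move=> k; have [_ /(_ i)[_ Cf]] := cvalP f a k.+1.
rewrite setTI in Cf; apply: Ck_eq Cf; first exact: cim_open.
by move=> _ [p ap <-]; rewrite /= /partial cmapK.
Qed.

(** A chart gives a frame of the tangent bundle near each point.  Cutting off
the chart vector fields and the coordinates makes them global; the support of
the fields can be taken in any given open set. *)
Lemma coordinate_frame (m0 : M) U : open U -> U m0 ->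
  exists V (X : 'I_n -> forall m, TM M m) (x : 'I_n -> Cinf M),
  [/\ open V /\ V m0, (forall i, vsec (TM M) (X i)),
      (forall i m, ~ U m -> X i m = 0),
      (forall m, V m -> forall i j, tangent_app (X i m) (x j) = (i == j)%:R) &
      (forall m, V m -> forall v : tangent m,
         v = \sum_i tangent_app v (x i) *: X i m)].
Proof.
move=> oU Um0; have [a am0] := cdom_cover m0.
pose U' : set M := U `&` cdom a.
have oU' : open U' by apply: openI => //; exact: cdom_open.
have [psi [V [W [[oV oW] [Vm0 VU] UW psi1 psi0]]]] :=
  bump_function oU' (conj Um0 am0).
have sx j : smooth_fun setT (fun m => psi m * cmap a m 0 j).
  apply: (smooth_fun_bump oU' oW) => //.
  by apply: smooth_fun_sub (chart_coord_smooth a j) => m [].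
pose x j := CInf (sx j).
pose F i m f : R := if `[< cdom a m >] then psi m * partial a i f m else 0.
have tF i m : F i m \in sp_pred (Subspace (@tangent_closed R n M m)).
  apply/asboolP; rewrite /F; case: asboolP => am /=.
    have [_ _ SZ] := @tangent_closed R n M m.
    exact: (SZ (psi m) _ (partial_tangent i am)).
  by have [S0 _ _] := @tangent_closed R n M m.
pose X i m : TM M m := Subsp (tF i m).
have XE i m f : cdom a m -> tangent_app (X i m) f = psi m * partial a i f m.
  by move=> am; rewrite /tangent_app /= /F asboolT.
have x_partial m : V m -> forall i j, partial a i (x j) m = (i == j)%:R.
  move=> Vm i j; have [_ am] := VU m Vm.
  rewrite (@partial_local a i _ (fun p => cmap a p 0 j) m V) //; last first.
    by move=> p Vp; rewrite /= psi1 // mul1r.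
  rewrite /partial (near_eq_derive (g := fun y : 'rV[R]_n => y 0 j)).
    by have [_ ->] := is_derive_coord i j (cmap a m).
  apply: filterS (near_chart oV Vm am) => y [_ [p ap <-]].
  by rewrite /= cmapK.
exists V, X, x; split=> //.
- move=> i f.
  have -> : (fun m => tangent_app (X i m) f) = fun m => psi m *
      (if `[< cdom a m >] then partial a i f m else 0).
    apply/funext => m; rewrite /tangent_app /= /F.
    by case: asboolP => // _; rewrite mulr0.
  apply: (smooth_fun_bump oU' oW) => //.
  apply: (@smooth_fun_eq _ _ _ _ (partial a i f)) => //.
    by move=> p [_ ap]; rewrite asboolT.
  by apply: smooth_fun_sub (@partial_smooth a i f) => p [].
- move=> i m nUm; apply: tangent_ext => f; rewrite /tangent_app /= /F.
  by case: asboolP => // _; rewrite psi0 ?mul0r //; case: (UW m) => // -[].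
- move=> m Vm i j; have [_ am] := VU m Vm.
  by rewrite XE // psi1 // mul1r x_partial.
- move=> m Vm v; have [_ am] := VU m Vm.
  have /asboolP/(_ a am)[c vE] := sp_valP v.
  apply: tangent_ext => f.
  rewrite [LHS]vE tangent_app_sum; apply: eq_bigr => i _; rewrite XE // psi1 // mul1r.
  congr (_ * _); rewrite /tangent_app vE (bigD1 i) //= x_partial // eqxx mulr1.
  by rewrite big1 ?addr0 // => j ji; rewrite x_partial // (negbTE ji) mulr0.
Qed.

End TangentVectors.

(** * Local frames and vector bundles *)

Section LinearMaps.
Variables (R : realType) (V W : lmodType R).

Definition mk_linear (f : V -> W) (fL : linear f) : {linear V -> W} :=
  HB.pack f (GRing.isLinear.Build R V W _ f fL).

End LinearMaps.

Section LocalFrames.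
Variables (R : realType) (n : nat) (M : manifold R n).
Implicit Types (F : vfamily M) (D : finType).

Definition sheaf_family F := forall s, (forall m, exists U t,
  [/\ open U, U m, vsec F t & forall p, U p -> t p = s p]) -> vsec F s.

Definition module_family F := [/\ vsec F (fun=> 0),
  (forall s t, vsec F s -> vsec F t -> vsec F (fun m => s m + t m)) &
  (forall (f : Cinf M) s, vsec F s -> vsec F (fun m => f m *: s m))].

(** Both the frame and its dual consist of sections over all of [M], and only
their being dual bases is restricted to a neighbourhood of [m0].  By cutting
off, every local frame shrinks to one of this form, and then sections of [F]
can be expanded and combined without partially defined objects. *)
Record local_frame F D (m0 : M) := LocalFrame {
  lf_dom : set M;
  lf_open : open lf_dom;
  lf_mem : lf_dom m0;
  lf_sec : D -> forall m, F m;
  lf_dual : D -> forall m, {linear F m -> R^o};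
  lf_secP : forall d, vsec F (lf_sec d);
  lf_dualP : forall d s, vsec F s -> smooth_fun setT (fun m => lf_dual d m (s m));
  lf_expand : forall m, lf_dom m ->
    forall x, x = \sum_d lf_dual d m x *: lf_sec d m;
  lf_dualE : forall m, lf_dom m ->
    forall d d', lf_dual d m (lf_sec d' m) = (d == d')%:R }.

Definition framed F D := forall m, inhabited (local_frame F D m).

Lemma module_sum F D (f : D -> Cinf M) (s : D -> forall m, F m) :
  module_family F -> (forall d, vsec F (s d)) ->
  vsec F (fun m => \sum_d f d m *: s d m).
Proof.
move=> [F0 FD FZ] Fs; elim: (index_enum D) => [|d e IH].
  rewrite [X in vsec F X](_ : _ = fun=> 0) //.
  by apply/functional_extensionality_dep => m; rewrite big_nil.
rewrite [X in vsec F X](_ : _ =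
    fun m => f d m *: s d m + \sum_(d <- e) f d m *: s d m).
  by apply: FD => //; exact: FZ.
by apply/functional_extensionality_dep => m; rewrite big_cons.
Qed.

(** The coefficients of a section in a frame are its values under the dual
frame, hence smooth; conversely a section with smooth coefficients agrees near
each point with a combination of the frame with global coefficients. *)
Lemma frames_vector_bundle F (r : nat) : sheaf_family F -> module_family F ->
  framed F 'I_r -> is_vector_bundle F.
Proof.
move=> sF mF frF.
have frE m : exists x : local_frame F 'I_r m, True by have [x] := frF m; exists x.
pose fr m := projT1 (cid (frE m)).
have basis a m : lf_dom (fr a) m -> is_basis (fun i => lf_sec (fr a) i m).
  move=> am x; exists (fun i => lf_dual (fr a) i m x).
  split=> [|c ->]; first exact: lf_expand.
  apply/funext => i; rewrite linear_sum (bigD1 i) //= linearZ /=.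
  rewrite lf_dualE // eqxx [_ *: _]mulr1 big1 ?addr0 // => j ji.
  by rewrite linearZ /= lf_dualE // eq_sym (negbTE ji) scaler0.
have trans a b i : exists2 g : 'I_r -> M -> R,
    (forall j, smooth_fun (lf_dom (fr a) `&` lf_dom (fr b)) (g j)) &
    forall m, lf_dom (fr a) m -> lf_dom (fr b) m ->
      lf_sec (fr b) i m = \sum_j g j m *: lf_sec (fr a) j m.
  exists (fun j m => lf_dual (fr a) j m (lf_sec (fr b) i m)) => [j|m am _].
    by apply: (@smooth_fun_sub _ _ _ _ setT) => //; apply: lf_dualP; exact: lf_secP.
  exact: lf_expand.
exists r, (@VBAtlas _ _ _ r F M _ (fun a => lf_sec (fr a))
  (fun a => lf_open (fr a)) (fun m => ex_intro (fun a => lf_dom (fr a) m) m (lf_mem (fr m))) basis trans).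
apply/seteqP; split=> s Fs.
  move=> a /=; exists (fun j m => lf_dual (fr a) j m (s m)) => [j|m am].
    by apply: (@smooth_fun_sub _ _ _ _ setT) => //; exact: lf_dualP.
  exact: lf_expand.
apply: sF => m; have [/= g sg sE] := Fs m.
have [psi [V [W [[oV oW] [Vm VU] UW psi1 psi0]]]] :=
  bump_function (lf_open (fr m)) (lf_mem (fr m)).
have sG j := smooth_fun_bump (lf_open (fr m)) oW UW psi0 (sg j).
exists V, (fun m' => \sum_j CInf (sG j) m' *: lf_sec (fr m) j m'); split=> //.
  by apply: module_sum => // j; exact: lf_secP.
move=> p Vp; rewrite (sE _ (VU p Vp)); apply: eq_bigr => j _ /=.
by rewrite psi1 // mul1r.
Qed.

End LocalFrames.

Section BundleFrames.
Variables (R : realType) (n : nat) (M : manifold R n).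

Section Atlas.
Variables (r : nat) (E : vbundle M r).
Local Notation A := (vb_str E).

(** The default [0] off the domain of the frame makes the coordinates linear at
every point. *)
Definition frame_coord (a : fidx A) (j : 'I_r) m (x : E m) : R :=
  if pselect (fdom a m) is left am then projT1 (cid (frame_basis am x)) j else 0.

Lemma frame_coordP (a : fidx A) m (x : E m) (c : 'I_r -> R) : fdom a m ->
  x = \sum_j c j *: frame a j m -> forall j, frame_coord a j x = c j.
Proof.
move=> am xE j; rewrite /frame_coord; case: pselect => // am'.
by case: cid => c' [_ uc] /=; rewrite (uc c).
Qed.

Lemma frame_coordE (a : fidx A) m (x : E m) : fdom a m ->
  x = \sum_j frame_coord a j x *: frame a j m.
Proof.
move=> am; have [c [xE _]] := frame_basis am x.
by rewrite {1}xE; apply: eq_bigr => j _; rewrite (frame_coordP am xE).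
Qed.

Lemma frame_coord_linear (a : fidx A) j m :
  linear (@frame_coord a j m : E m -> R^o).
Proof.
move=> c x y; have [am|nam] := pselect (fdom a m); last first.
  by rewrite /frame_coord; case: pselect => // _; rewrite scaler0 addr0.
apply: (frame_coordP (c := fun j => c * frame_coord a j x + frame_coord a j y)) => //.
rewrite {1}(frame_coordE x am) {1}(frame_coordE y am) scaler_sumr -big_split /=.
by apply: eq_bigr => i _; rewrite scalerDl scalerA.
Qed.

(** Coordinates are unique, so that smoothness of a section becomes a condition on
given functions, which can be checked locally. *)
Lemma smooth_sectionP s : vsec E s <->
  forall (a : fidx A) j, smooth_fun (fdom a) (fun m => frame_coord a j (s m)).
Proof.
split=> [Es a j|H a].
  have [g sg sE] := Es a; apply: smooth_fun_eq (sg j); first exact: fdom_open.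
  by move=> p ap; rewrite (frame_coordP ap (sE p ap)).
by exists (fun j m => frame_coord a j (s m)) => // m; exact: frame_coordE.
Qed.

Lemma bundle_sheaf : sheaf_family E.
Proof.
move=> s H; apply/smooth_sectionP => a j; apply: smooth_fun_local => m am.
have [U [t [oU Um /smooth_sectionP Et ts]]] := H m.
exists (fdom a `&` U), (fun m => frame_coord a j (t m)); split=> //.
- by apply: openI => //; exact: fdom_open.
- by apply: smooth_fun_sub (Et a j) => p [].
- by move=> p [_ Up]; rewrite ts.
Qed.

Lemma bundle_module : module_family E.
Proof.
split=> [|s t Es Et|f s Es].
- by have [H _ _] := Gamma_closed E.
- by have [_ H _] := Gamma_closed E; exact: H.
- by have /asboolP := Gamma_mulP f (Subsp (asboolT Es : _ \in sp_pred (Subspace (Gamma_closed E)))).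
Qed.

Lemma bundle_framed : framed E 'I_r.
Proof.
move=> m0; have [a am0] := fdom_cover A m0.
have [psi [V [W [[oV oW] [Vm0 VU] UW psi1 psi0]]]] :=
  bump_function (fdom_open a) am0.
have EL i m : linear (fun x : E m => psi m * frame_coord a i x : R^o).
  by move=> c x y; rewrite frame_coord_linear [LHS]scalerDr [psi m *: _]mulrCA.
constructor; apply: (@LocalFrame _ _ _ E 'I_r m0 V oV Vm0
  (fun i m => psi m *: frame a i m) (fun i m => mk_linear (EL i m))).
- move=> i; apply/smooth_sectionP => b j.
  have [g sg gE] := frame_transition b a i.
  apply: (@smooth_fun_local _ _ _ (fdom b)) => m bm; have [am|Wm] := UW m.
    exists (fdom b `&` fdom a), (fun m => psi m * g j m); split=> //.
    + by apply: openI; exact: fdom_open.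
    + apply: smooth_fun_mul; [by apply: openI; exact: fdom_open| |exact: sg].
      by apply: smooth_fun_sub (cvalP psi).
    + move=> p [bp ap]; rewrite (frame_coordP (c := fun j => psi p * g j p)) //.
      rewrite gE // scaler_sumr.
      by apply: eq_bigr => l _; rewrite scalerA.
  exists W, (fun=> 0); split=> //; first exact: smooth_fun_cst.
  move=> p Wp; rewrite psi0 // scale0r.
  by have := linear0 (mk_linear (@frame_coord_linear b j p)).
- move=> i s /smooth_sectionP Es.
  by apply: (smooth_fun_bump (fdom_open a) oW UW psi0); exact: Es.
- move=> m Vm x; rewrite {1}(frame_coordE x (VU m Vm)).
  by apply: eq_bigr => j _; rewrite /= psi1 // mul1r scale1r.
- move=> m Vm i j; rewrite /= psi1 // mul1r scale1r.
  apply: (frame_coordP (c := fun i => (i == j)%:R)); first exact: VU.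
  rewrite (bigD1 j) //= eqxx scale1r big1 ?addr0 // => l /negbTE->.
  by rewrite scale0r.
Qed.

End Atlas.

Lemma tangent_app_linear m (f : Cinf M) :
  linear (fun v : tangent m => tangent_app v f : R^o).
Proof. by []. Qed.

Definition tangent_ev m (f : Cinf M) : {linear tangent m -> R^o} :=
  mk_linear (@tangent_app_linear m f).

Lemma TM_sheaf : sheaf_family (TM M).
Proof.
move=> X H f; apply: smooth_fun_local => m _.
have [U [Y [oU Um sY YX]]] := H m.
exists U, (fun m => tangent_app (Y m) f); split=> //; last by move=> p Up; rewrite YX.
by apply: smooth_fun_sub (sY f).
Qed.

Lemma TM_module : module_family (TM M).
Proof.
split=> [f|X Y sX sY f|g X sX f]; first exact: smooth_fun_cst.
- by apply: smooth_fun_add; [exact: openT|exact: sX|exact: sY].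
- by apply: smooth_fun_mul; [exact: openT|exact: cvalP|exact: sX].
Qed.

Lemma TM_framed : framed (TM M) 'I_n.
Proof.
move=> m0; have [V [X [x [[oV Vm0] sX _ Xx XE]]]] := coordinate_frame openT (I : setT m0).
constructor; apply: (@LocalFrame _ _ _ (TM M) 'I_n m0 V oV Vm0 X
  (fun i m => tangent_ev m (x i))) => //.
- by move=> i s; exact.
- by move=> m Vm i j; rewrite /= Xx // eq_sym.
Qed.

End BundleFrames.

(** * Multilinear algebra *)

Section FiniteDimension.
Variables (R : realType) (A : lmodType R) (T : finType) (ev : T -> {linear A -> R^o}).
Hypothesis ev_inj : forall x, (forall t, ev t x = 0) -> x = 0.
Variable S : set A.
Hypothesis SD : forall x y, S x -> S y -> S (x + y).
Hypothesis SZ : forall (c : R) x, S x -> S (c *: x).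

Let dual_system N (B : 'I_N -> A) (l : 'I_N -> T -> R) :=
  (forall s, S (B s)) /\
  forall s s', \sum_t l s t * ev t (B s') = (s == s')%:R.

(** The two arrays of a dual system are matrices whose product is the identity,
of size at most the inner dimension. *)
Let dual_system_bound N B l : @dual_system N B l -> (N <= #|T|)%N.
Proof.
move=> [_ Bl].
pose P : 'M[R]_(N, #|T|) := \matrix_(s, t) l s (enum_val t).
pose Q : 'M[R]_(#|T|, N) := \matrix_(t, s) ev (enum_val t) (B s).
have PQ : P *m Q = 1%:M.
  apply/matrixP => s s'; rewrite !mxE -Bl.
  rewrite (reindex_onto (enum_val : 'I_#|T| -> T) enum_rank) /=; last first.
    by move=> t _; exact: enum_rankK.
  by apply: eq_big => [t|t _]; rewrite ?enum_valK ?eqxx // !mxE.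
rewrite -[X in (X <= _)%N](mxrank1 R) -PQ.
exact: leq_trans (mxrankM_maxl P Q) (rank_leq_col P).
Qed.

(** A maximal system in duality spans: a vector of [S] outside the span could
be corrected to be killed by the functionals of the system, and then added. *)
Lemma subspace_basis : exists N (B : 'I_N -> A) (l : 'I_N -> T -> R),
  [/\ forall s, S (B s),
      forall x, S x -> x = \sum_s (\sum_t l s t * ev t x) *: B s &
      forall s s', \sum_t l s t * ev t (B s') = (s == s')%:R].
Proof.
pose P N := `[< exists B l, @dual_system N B l >].
have ex0 : exists N, P N.
  by exists 0%N; apply/asboolP; exists (fun=> 0), (fun _ _ => 0); split=> -[].
have bound N : P N -> (N <= #|T|)%N.
  by move=> /asboolP[B [l Bl]]; exact: dual_system_bound Bl.
case: (ex_maxnP ex0 bound) => N /asboolP[B [l [SB Bl]]] maxN.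
exists N, B, l; split=> // x Sx; apply: contrapT => xE.
pose L s y : R := \sum_t l s t * ev t y.
have LD s y z : L s (y - z) = L s y - L s z.
  rewrite /L -sumrB; apply: eq_bigr => t _.
  by rewrite linearB mulrBr.
pose y := x - \sum_s L s x *: B s.
have SN : S (- \sum_s L s x *: B s).
  have S0 : S 0 by have := SZ 0 Sx; rewrite scale0r.
  rewrite -scaleN1r; apply: SZ.
  by elim/big_ind: _ => // s _; exact: SZ.
have Sy : S y by exact: SD.
have Ly s : L s y = 0.
  rewrite LD (_ : L s (\sum_ _ _) = L s x) ?subrr // /L.
  under eq_bigr do rewrite linear_sum mulr_sumr.
  rewrite exchange_big (bigD1 s) //= [X in _ + X]big1 ?addr0 => [|s' s's].
    under eq_bigr do rewrite linearZ /= [_ *: _]mulrC mulrA.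
    by rewrite -mulr_suml Bl eqxx mul1r.
  under eq_bigr do rewrite linearZ /= [_ *: _]mulrC mulrA.
  by rewrite -mulr_suml Bl eq_sym (negbTE s's) mul0r.
have [t yt] : exists t, ev t y != 0.
  apply: contrapT => H; apply: xE; apply/eqP; rewrite -subr_eq0; apply/eqP.
  by apply: ev_inj => t; apply: contrapT => /eqP yt; apply: H; exists t.
pose u := ev t y.
(* [y] completes the vectors, and [ev t], corrected to vanish on the old vectors
   and normalized at [y], completes the functionals. *)
pose B' (s : 'I_N.+1) := if unlift ord_max s is Some s0 then B s0 else y.
pose l' (s : 'I_N.+1) := if unlift ord_max s is Some s0 then l s0 else
  fun t' => u^-1 * ((t' == t)%:R - \sum_s ev t (B s) * l s t').
have L' z : \sum_t' (u^-1 * ((t' == t)%:R - \sum_s ev t (B s) * l s t')) * ev t' z =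
    u^-1 * (ev t z - \sum_s ev t (B s) * L s z).
  under eq_bigr do rewrite -mulrA mulrBl.
  rewrite -mulr_sumr sumrB; congr (_ * (_ - _)).
    rewrite (bigD1 t) //= eqxx mul1r big1 ?addr0 // => t' /negbTE->.
    by rewrite mul0r.
  under eq_bigr do rewrite mulr_suml.
  rewrite exchange_big; apply: eq_bigr => s _; rewrite mulr_sumr.
  by apply: eq_bigr => t' _; rewrite mulrA.
have /maxN : P N.+1; last by rewrite ltnn.
apply/asboolP; exists B', l'; split=> [s|s s'].
  by rewrite /B'; case: unliftP => [s0|] _.
rewrite /B' /l'; case: unliftP => [s0 ->|->]; case: unliftP => [s1 ->|->].
- by rewrite Bl (inj_eq lift_inj).
- by rewrite -/(L s0 y) Ly eq_sym (negbTE (neq_lift _ _)).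
- rewrite L' (_ : \sum_s _ = ev t (B s1)) ?subrr ?mulr0 ?(negbTE (neq_lift _ _)) //.
  rewrite (bigD1 s1) //= /L Bl eqxx mulr1 big1 ?addr0 // => s2 s21.
  by rewrite Bl (negbTE s21) mulr0.
- rewrite L' big1 => [|s2 _]; last by rewrite Ly mulr0.
  by rewrite subr0 mulVf // eqxx.
Qed.

End FiniteDimension.

Section Multilinear.
Variables (R : realType) (k : nat) (V W : lmodType R).
Implicit Types (phi psi : ('I_k -> V) -> W) (mu : 'I_k -> V).

Definition multilinear phi :=
  forall mu i, linear (fun x => phi (subst_at mu i x)).

Lemma subst_at_id mu i : subst_at mu i (mu i) = mu.
Proof. by apply/funext => j; rewrite /subst_at; case: eqP => // ->. Qed.

Lemma multilinear0 phi mu i : multilinear phi -> mu i = 0 -> phi mu = 0.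
Proof.
move=> ml mu0; rewrite -(subst_at_id mu i) mu0.
by have := linear0 (mk_linear (ml mu i)).
Qed.

(** Changing the arguments one at a time. *)
Lemma multilinear_congr phi (P : V -> Prop) mu mu' : multilinear phi ->
  (forall mu i, P (mu i) -> phi mu = 0) -> (forall i, P (mu i - mu' i)) ->
  phi mu = phi mu'.
Proof.
move=> ml phi0 Pmu.
pose mix (j : nat) (i : 'I_k) := if (i < j)%N then mu' i else mu i.
have mixE j : (j <= k)%N -> phi (mix j) = phi mu.
  elim: j => [|j IH] jk; first by congr phi; apply/funext.
  pose i0 := Ordinal jk; rewrite -(IH (ltnW jk)).
  have mixi : mix j = subst_at (mix j) i0 (mu i0).
    apply/funext => i; rewrite /subst_at; case: eqP => // ->.
    by rewrite /mix ltnn.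
  have -> : mix j.+1 = subst_at (mix j) i0 (mu' i0).
    apply/funext => i; rewrite /subst_at /mix ltnS leq_eqVlt -val_eqE /=.
    by case: eqP => [/= e|//]; congr mu'; exact: val_inj.
  rewrite [in RHS]mixi -[mu i0](subrK (mu' i0)).
  rewrite -[X in subst_at _ _ (X + _)]scale1r (ml (mix j) i0) scale1r.
  by rewrite (phi0 (subst_at (mix j) i0 (mu i0 - mu' i0)) i0) ?add0r // /subst_at eqxx.
rewrite -(mixE k (leqnn k)); congr phi; apply/funext => i.
by rewrite /mix ltn_ord.
Qed.

Section Basis.
Variables (D : finType) (e : D -> V) (xi : D -> {linear V -> R^o}).
Hypothesis expand : forall x, x = \sum_d xi d x *: e d.
Hypothesis dual : forall d d', xi d (e d') = (d == d')%:R.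

(** Replacing the basis vectors by arbitrary arguments one slot at a time. *)
Lemma multilinear_ext phi psi : multilinear phi -> multilinear psi ->
  (forall I : {ffun 'I_k -> D}, phi (e \o I) = psi (e \o I)) -> phi = psi.
Proof.
move=> mphi mpsi epp.
have H j : (j <= k)%N -> forall mu,
    (forall i : 'I_k, (j <= i)%N -> exists d, mu i = e d) -> phi mu = psi mu.
  elim: j => [|j IH] jk mu mue.
    have I i : {d | mu i = e d} by apply: cid; exact: mue.
    have -> : mu = e \o [ffun i => projT1 (I i)].
      by apply/funext => i; rewrite /= ffunE; case: (I i).
    exact: epp.
  pose i0 := Ordinal jk; rewrite -(subst_at_id mu i0) (expand (mu i0)).
  have := linear_sum (mk_linear (mphi mu i0)) => /= ->.
  have := linear_sum (mk_linear (mpsi mu i0)) => /= ->.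
  apply: eq_bigr => d _.
  have := linearZ_LR (mk_linear (mphi mu i0)) => /= ->.
  have := linearZ_LR (mk_linear (mpsi mu i0)) => /= ->.
  congr (_ *: _); apply: IH => [|i ji]; first exact: ltnW.
  rewrite /subst_at; case: eqP => [_|/eqP ii0]; first by exists d.
  by apply: mue; rewrite ltn_neqAle ji andbT eq_sym.
by apply/funext => mu; apply: (H k (leqnn k)) => i; rewrite leqNgt ltn_ord.
Qed.

(** The right hand side is multilinear and agrees with [phi] on the basis. *)
Lemma multilinear_expand phi mu : multilinear phi ->
  phi mu = \sum_(I : {ffun 'I_k -> D}) (\prod_a xi (I a) (mu a)) *: phi (e \o I).
Proof.
move=> mphi; move: mu.
suff : phi = fun mu => \sum_(I : {ffun 'I_k -> D})
    (\prod_a xi (I a) (mu a)) *: phi (e \o I).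
  by move=> H mu; rewrite {1}H.
apply: multilinear_ext => // [mu i c x y|J].
  rewrite scaler_sumr -big_split /=; apply: eq_bigr => I _.
  rewrite scalerA -scalerDl; congr (_ *: _).
  rewrite (bigD1 i) //= [X in _ = c * X + _](bigD1 i) //=.
  rewrite [X in _ = _ + X](bigD1 i) //= /subst_at eqxx linearP mulrDl.
  by rewrite -mulrA; congr (c * (_ * _) + _ * _); apply: eq_bigr => a /negbTE->.
rewrite (bigD1 J) //= [\prod_a _]big1 ?scale1r => [|a _]; last first.
  by rewrite dual eqxx.
rewrite big1 ?addr0 // => I IJ.
have [a Ia] : exists a, I a != J a.
  by apply/existsP; apply: contraNT IJ => /existsPn H; apply/eqP/ffunP => a;
    apply/eqP; rewrite -[_ == _]negbK.
by rewrite (bigD1 a) //= dual (negbTE Ia) mul0r scale0r.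
Qed.

End Basis.

Lemma alt_transpose phi mu i j : alt_set phi -> i != j ->
  phi (mu \o tperm i j) = - phi mu.
Proof.
move=> [ml al] ij; pose f x y := phi (subst_at (subst_at mu i x) j y).
have fxx x : f x x = 0.
  by apply: (al _ i j) => //; rewrite /subst_at !eqxx (negbTE ij).
have fDr x y z : f x (y + z) = f x y + f x z.
  by have := raddfD (mk_linear (ml (subst_at mu i x) j)); exact.
have swap x y : subst_at (subst_at mu i x) j y = subst_at (subst_at mu j y) i x.
  apply/funext => l; rewrite /subst_at; case: eqP => // ->.
  by rewrite eq_sym (negbTE ij).
have fDl x y z : f (x + y) z = f x z + f y z.
  rewrite /f !swap.
  by have := raddfD (mk_linear (ml (subst_at mu j z) i)); exact.
have := fxx (mu i + mu j); rewrite fDr !fDl !fxx add0r addr0 => /eqP.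
rewrite addr_eq0 => /eqP H.
have -> : phi (mu \o tperm i j) = f (mu j) (mu i).
  congr phi; apply/funext => l; rewrite /subst_at /=.
  case: tpermP => [->|->|/eqP li /eqP lj].
  - by rewrite (negbTE ij) eqxx.
  - by rewrite eqxx.
  - by rewrite (negbTE li) (negbTE lj).
rewrite H; congr (- phi _); apply/funext => l; rewrite /subst_at.
by case: eqP => [->//|_]; case: eqP => [->|].
Qed.

Lemma alt_perm phi mu (s : 'S_k) : alt_set phi ->
  phi (mu \o s) = (-1) ^+ s *: phi mu.
Proof.
move=> al; have [ts -> dts] := prod_tpermP s.
elim: ts dts => [_|t ts IH /= /andP[dt /IH IHts]].
  rewrite big_nil odd_perm1 scale1r; congr phi; apply/funext => i.
  by rewrite /= perm1.
rewrite big_cons odd_permM odd_tperm dt signr_addb -scalerA -IHts.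
rewrite expr1 scaleN1r -(alt_transpose _ al dt); congr phi.
by apply/funext => i; rewrite /= permM.
Qed.

(** Summing [multilinear_expand] over the permutations of the arguments, with
signs, turns the products of coordinates into determinants. *)
Lemma alt_expand phi mu (D : finType) (e : D -> V) (xi : D -> {linear V -> R^o}) :
  alt_set phi -> (forall x, x = \sum_d xi d x *: e d) ->
  (forall d d', xi d (e d') = (d == d')%:R) ->
  k`!%:R *: phi mu = \sum_(I : {ffun 'I_k -> D})
    \det (\matrix_(l, a) xi (I a) (mu l)) *: phi (e \o I).
Proof.
move=> al expand dual; have [ml _] := al.
have -> : k`!%:R *: phi mu = \sum_(s : 'S_k) (-1) ^+ s *: phi (mu \o s).
  rewrite (eq_bigr (fun=> phi mu)) => [|s _]; last first.
    by rewrite alt_perm // scalerA -signr_addb addbb scale1r.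
  by rewrite sumr_const (_ : #|_| = #|{perm 'I_k}|) ?card_Sn ?scaler_nat.
under eq_bigr do rewrite (multilinear_expand expand dual _ ml) scaler_sumr.
rewrite exchange_big; apply: eq_bigr => I _.
rewrite -det_tr /determinant scaler_suml; apply: eq_bigr => s _.
rewrite scalerA; congr (_ * _ *: _).
by apply: eq_bigr => a _; rewrite !mxE.
Qed.

End Multilinear.

Section AlternatingMaps.
Variables (R : realType) (k : nat) (V W : lmodType R).

Definition mk_alt (phi : ('I_k -> V) -> W) (H : alt_set phi) : alt k V W :=
  Subsp (asboolT H : _ \in sp_pred (Subspace (alt_closed k V W))).

Lemma altP (phi : alt k V W) : alt_set (alt_app phi).
Proof. by have /asboolP := sp_valP phi. Qed.

Lemma alt_ext (phi psi : alt k V W) :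
  (forall mu, alt_app phi mu = alt_app psi mu) -> phi = psi.
Proof. by move=> H; apply/val_inj/funext. Qed.

Lemma alt_app_linear mu : linear (fun phi : alt k V W => alt_app phi mu).
Proof. by []. Qed.

Lemma alt_app_sum (I : finType) (c : I -> R) (phi : I -> alt k V W) mu :
  alt_app (\sum_i c i *: phi i) mu = \sum_i c i *: alt_app (phi i) mu.
Proof.
elim: (index_enum I) => [|i s IH]; first by rewrite !big_nil.
by rewrite !big_cons -IH.
Qed.

End AlternatingMaps.

(** * Bundles of alternating maps *)

Section HomBundles.
Variables (R : realType) (n : nat) (M : manifold R n) (k : nat) (B C : vfamily M).

Lemma HomAlt_sheaf : sheaf_family C -> sheaf_family (HomAlt k B C).
Proof.
move=> sC Phi H s Bs; apply: sC => m; have [U [Psi [oU Um hPsi PsiE]]] := H m.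
exists U, (fun m => alt_app (Psi m) (fun i => s i m)); split=> //.
  exact: hPsi.
by move=> p Up; rewrite PsiE.
Qed.

Lemma HomAlt_module : module_family C -> module_family (HomAlt k B C).
Proof.
move=> [C0 CD CZ]; split=> [s Bs|Phi Psi hPhi hPsi s Bs|f Phi hPhi s Bs].
- exact: C0.
- by apply: CD; [exact: hPhi|exact: hPsi].
- by apply: CZ; exact: hPhi.
Qed.

Variables (D Q : finType).

Local Notation model := (alt k {ffun D -> R^o} {ffun Q -> R^o}).

Definition unit_vector (d : D) : {ffun D -> R^o} := [ffun d' => (d' == d)%:R].

Lemma coordinate_linear (d : D) : linear (fun x : {ffun D -> R^o} => x d).
Proof. by move=> c x y; rewrite !ffunE. Qed.

Lemma unit_vector_expand (x : {ffun D -> R^o}) : x = \sum_d x d *: unit_vector d.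
Proof.
apply/ffunP => d; rewrite sum_ffunE (bigD1 d) //= !ffunE eqxx.
rewrite [_ *: _]mulr1 big1 ?addr0 // => d' d'd.
by rewrite !ffunE eq_sym (negbTE d'd) scaler0.
Qed.

Definition model_coord (t : {ffun 'I_k -> D} * Q) (phi : model) : R^o :=
  alt_app phi (fun a => unit_vector (t.1 a)) t.2.

Lemma model_coord_linear t : linear (model_coord t).
Proof. by move=> c x y; rewrite /model_coord [LHS]ffunE !ffunE. Qed.

Definition model_ev t : {linear model -> R^o} := mk_linear (@model_coord_linear t).

(** Polynomial dependence on the coordinates of the arguments; this is what makes
the transported sections below smooth. *)
Lemma model_expand (phi : model) (x : 'I_k -> {ffun D -> R^o}) q :
  alt_app phi x q = \sum_(I : {ffun 'I_k -> D})
    (\prod_a x a (I a)) * model_coord (I, q) phi.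
Proof.
have [ml _] := altP phi.
rewrite (multilinear_expand (e := unit_vector) (xi := fun d => mk_linear (@coordinate_linear d)) _ _ x ml).
- rewrite sum_ffunE; apply: eq_bigr => I _.
  by rewrite ffunE.
- exact: unit_vector_expand.
- by move=> d d'; rewrite /= ffunE.
Qed.

Lemma model_ev_inj phi : (forall t, model_ev t phi = 0) -> phi = 0.
Proof.
move=> H; apply: alt_ext => x; apply/ffunP => q.
rewrite model_expand big1 => [|I _]; first by rewrite [RHS]ffunE.
by have := H (I, q); rewrite /= => ->; rewrite mulr0.
Qed.

Section Frames.
Variables (m1 m2 : M) (b : local_frame B D m1) (c : local_frame C Q m2).

(** [up] and [down] transport alternating maps between the coordinate spaces and
the fibres.  Both are defined over all of [M], and are mutually inverse where
[b] and [c] are frames. *)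
Definition up_fun m (Phi : model) (mu : 'I_k -> B m) : C m :=
  \sum_q alt_app Phi (fun a => [ffun d => lf_dual b d m (mu a)]) q *: lf_sec c q m.

Lemma up_alt m Phi : alt_set (@up_fun m Phi).
Proof.
have [ml al] := altP Phi; split=> [mu i a x y|mu i j ij e].
  rewrite /up_fun scaler_sumr -big_split /=; apply: eq_bigr => q _.
  pose g z : {ffun D -> R^o} := [ffun d => lf_dual b d m z].
  have gs z : (fun a0 : 'I_k => [ffun d => lf_dual b d m (subst_at mu i z a0)]) =
      subst_at (fun a0 => g (mu a0)) i (g z).
    by apply/funext => j; rewrite /subst_at; case: eqP.
  rewrite !gs.
  have -> : g (a *: x + y) = a *: g x + g y.
    by apply/ffunP => d; rewrite !ffunE linearP.
  by rewrite ml !ffunE scalerDl scalerA.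
rewrite /up_fun big1 // => q _.
by rewrite (al _ i j) // ?ffunE ?scale0r // e.
Qed.

Definition up m Phi : alt k (B m) (C m) := mk_alt (@up_alt m Phi).

Definition down_fun m (phi : alt k (B m) (C m)) (x : 'I_k -> {ffun D -> R^o}) :
    {ffun Q -> R^o} :=
  [ffun q => lf_dual c q m (alt_app phi (fun a => \sum_d x a d *: lf_sec b d m))].

Lemma down_alt m phi : alt_set (@down_fun m phi).
Proof.
have [ml al] := altP phi; split=> [x i a y z|x i j ij e].
  apply/ffunP => q; rewrite !ffunE.
  pose g z := \sum_d z d *: lf_sec b d m.
  have gs z' : (fun a0 : 'I_k => \sum_d subst_at x i z' a0 d *: lf_sec b d m) =
      subst_at (fun a0 => g (x a0)) i (g z').
    by apply/funext => j; rewrite /subst_at; case: eqP.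
  rewrite !gs.
  have -> : g (a *: y + z) = a *: g y + g z.
    rewrite /g scaler_sumr -big_split /=; apply: eq_bigr => d _.
    by rewrite !ffunE scalerDl scalerA.
  by rewrite ml linearP.
apply/ffunP => q; rewrite !ffunE (al _ i j) // ?linear0 //.
by apply: eq_bigr => d _; rewrite e.
Qed.

Definition down m phi : model := mk_alt (@down_alt m phi).

Lemma upE m Phi mu : alt_app (up m Phi) mu = \sum_q
  alt_app Phi (fun a => [ffun d => lf_dual b d m (mu a)]) q *: lf_sec c q m.
Proof. by []. Qed.

Lemma downE m phi x q : alt_app (@down m phi) x q =
  lf_dual c q m (alt_app phi (fun a => \sum_d x a d *: lf_sec b d m)).
Proof. exact: ffunE. Qed.

Lemma up_sum m (I : finType) (a : I -> R) (Phi : I -> model) :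
  up m (\sum_i a i *: Phi i) = \sum_i a i *: up m (Phi i).
Proof.
apply: alt_ext => mu; rewrite alt_app_sum upE.
under eq_bigr do rewrite alt_app_sum sum_ffunE scaler_suml.
rewrite exchange_big; apply: eq_bigr => i _; rewrite upE scaler_sumr.
by apply: eq_bigr => q _; rewrite ffunE scalerA.
Qed.

Lemma down_linear m : linear (@down m).
Proof.
move=> a phi psi; apply: alt_ext => x; apply/ffunP => q.
rewrite [RHS]ffunE [X in _ = X + _]ffunE !downE.
exact: (linearP (lf_dual c q m)).
Qed.

Lemma upK m Phi : lf_dom b m -> lf_dom c m -> down (up m Phi) = Phi.
Proof.
move=> bm cm; apply: alt_ext => x; apply/ffunP => q.
rewrite downE upE linear_sum (bigD1 q) //= linearZ /=.
rewrite lf_dualE // eqxx big1 ?addr0 => [|q' q'q]; last first.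
  by rewrite linearZ /= lf_dualE // eq_sym (negbTE q'q) scaler0.
rewrite [LHS]mulr1; congr (alt_app Phi _ q).
apply/funext => a; apply/ffunP => d; rewrite ffunE linear_sum (bigD1 d) //=.
rewrite linearZ /= lf_dualE // eqxx [_ *: _]mulr1 big1 ?addr0 // => d' d'd.
by rewrite linearZ /= lf_dualE // eq_sym (negbTE d'd) scaler0.
Qed.

Lemma downK m phi : lf_dom b m -> lf_dom c m -> up m (down phi) = phi.
Proof.
move=> bm cm; apply: alt_ext => mu; rewrite upE.
rewrite [RHS](lf_expand cm); apply: eq_bigr => q _; rewrite downE.
congr (lf_dual c q m (alt_app phi _) *: _); apply/funext => a.
by rewrite [RHS](lf_expand bm); apply: eq_bigr => d _; rewrite ffunE.
Qed.

Lemma up_smooth Phi : module_family C -> vsec (HomAlt k B C) (fun m => up m Phi).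
Proof.
move=> mC s Bs.
have sf q : smooth_fun setT (fun m =>
    alt_app Phi (fun a => [ffun d => lf_dual b d m (s a m)]) q).
  under eq_fun do rewrite model_expand.
  apply: smooth_fun_sum => [|I]; first exact: openT.
  apply: smooth_fun_mul; [exact: openT| |exact: smooth_fun_cst].
  apply: smooth_fun_prod => [|a]; first exact: openT.
  by under eq_fun do rewrite ffunE; exact: lf_dualP.
by apply: (module_sum (fun q => CInf (sf q))) => // q; exact: lf_secP.
Qed.

Lemma down_smooth Phi t : vsec (HomAlt k B C) Phi ->
  smooth_fun setT (fun m => model_coord t (down (Phi m))).
Proof.
move=> hPhi; under eq_fun do rewrite /model_coord downE.
apply: lf_dualP.
have -> : (fun m => alt_app (Phi m)
    (fun a => \sum_d unit_vector (t.1 a) d *: lf_sec b d m)) =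
    (fun m => alt_app (Phi m) (fun a => lf_sec b (t.1 a) m)).
  apply/functional_extensionality_dep => m; congr alt_app; apply/funext => a.
  rewrite (bigD1 (t.1 a)) //= ffunE eqxx scale1r big1 ?addr0 // => d.
  by move/negbTE => da; rewrite ffunE da scale0r.
by apply: hPhi => a; exact: lf_secP.
Qed.

End Frames.

(** A family of subspaces of [Hom(/\^k B, C)] that suitable local frames of [B]
and [C] identify with one and the same space [S] of alternating maps between
coordinate spaces is a vector bundle, with a basis of [S] as local frame. *)
Lemma alt_subbundle (F : vfamily M) (iota : forall m, {linear F m -> alt k (B m) (C m)})
    (S : Defs.subspace model) : sheaf_family C -> module_family C ->
  (forall m, injective (iota m)) ->
  (forall s, vsec F s <-> vsec (HomAlt k B C) (fun m => iota m (s m))) ->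
  (forall m0, exists (b : local_frame B D m0) (c : local_frame C Q m0),
     (forall m, lf_dom b m -> lf_dom c m ->
        forall y, sp_set S (down b c (iota m y))) /\
     (forall Phi m, sp_set S Phi -> exists y, iota m y = up b c m Phi)) ->
  is_vector_bundle F.
Proof.
move=> sC mC iinj FE frames.
have [_ SD SZ] := sp_closed S.
have [N [Bs [l [SB expand dual]]]] := subspace_basis model_ev_inj SD SZ.
apply: (@frames_vector_bundle _ _ _ F N).
- move=> s H; apply/FE; apply: HomAlt_sheaf => // m.
  have [U [t [oU Um /FE Ft ts]]] := H m.
  by exists U, (fun m => iota m (t m)); split=> // p Up; rewrite ts.
- have [H0 HD HZ] := HomAlt_module mC.
  split=> [|s t /FE Fs /FE Ft|f s /FE Fs]; apply/FE.
  + rewrite [X in vsec _ X](_ : _ = fun=> 0) //.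
    by apply/functional_extensionality_dep => m; exact: linear0.
  + rewrite [X in vsec _ X](_ : _ = fun m => iota m (s m) + iota m (t m)).
      exact: HD.
    by apply/functional_extensionality_dep => m; exact: linearD.
  + rewrite [X in vsec _ X](_ : _ = fun m => f m *: iota m (s m)).
      exact: HZ.
    by apply/functional_extensionality_dep => m; exact: linearZ.
move=> m0; have [b [c [dS uS]]] := frames m0.
have secE s m : {y | iota m y = up b c m (Bs s)} by apply: cid; exact: uS.
pose e s m : F m := projT1 (secE s m).
have eE s m : iota m (e s m) = up b c m (Bs s) := projT2 (secE s m).
have dualL s m : linear (fun y : F m =>
    \sum_t l s t * model_coord t (down b c (iota m y)) : R^o).
  move=> a x y; rewrite scaler_sumr -big_split /=; apply: eq_bigr => t _.
  rewrite linearP down_linear.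
  have := linearP (model_ev t) a (down b c (iota m x)) (down b c (iota m y)).
  by rewrite /= => ->; rewrite mulrDr mulrCA.
constructor; apply: (@LocalFrame _ _ _ F 'I_N m0 (lf_dom b `&` lf_dom c)
  _ _ e (fun s m => mk_linear (dualL s m))).
- by apply: openI; exact: lf_open.
- by split; exact: lf_mem.
- move=> s; apply/FE; rewrite [X in vsec _ X](_ : _ = fun m => up b c m (Bs s)).
    exact: up_smooth.
  by apply/functional_extensionality_dep => m; exact: eE.
- move=> s f /FE Ff /=; apply: smooth_fun_sum => [|t]; first exact: openT.
  apply: smooth_fun_mul; [exact: openT|exact: smooth_fun_cst|].
  exact: (down_smooth b c t Ff).
- move=> m [bm cm] y; apply: iinj; rewrite linear_sum /=.
  under eq_bigr do rewrite linearZ /= eE.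
  by rewrite -up_sum -(expand _ (dS m bm cm y)) downK.
- by move=> m [bm cm] s s'; rewrite /= -dual; apply: eq_bigr => t _; rewrite eE upK.
Qed.

Lemma HomAlt_bundle : sheaf_family C -> module_family C ->
  framed B D -> framed C Q -> is_vector_bundle (HomAlt k B C).
Proof.
move=> sC mC fB fC.
have T : [/\ [set: model] 0,
   (forall x y, [set: model] x -> [set: model] y -> [set: model] (x + y)) &
   (forall (c : R) x, [set: model] x -> [set: model] (c *: x))] by [].
apply: (@alt_subbundle (HomAlt k B C) (fun m => idfun) (Subspace T)) => //.
- by move=> m0; have [b] := fB m0; have [c] := fC m0; exists b, c;
    split=> // Phi m _; exists (up b c m Phi).
Qed.

End HomBundles.

(** * Jets in a local frame *)

Section JetCalculus.
Variables (R : realType) (n : nat) (M : manifold R n) (r : nat) (E : vbundle M r).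

Definition gamma (s : forall m, E m) (Es : vsec E s) : Gamma E :=
  Subsp (asboolT Es : _ \in sp_pred (Subspace (Gamma_closed E))).

Lemma gammaP (u : Gamma E) : vsec E (sec_app u).
Proof. by have /asboolP := sp_valP u. Qed.

Lemma gamma_ext (u w : Gamma E) : (forall m, sec_app u m = sec_app w m) -> u = w.
Proof. by move=> H; apply/val_inj/functional_extensionality_dep. Qed.

Lemma sec_app_linear m : linear (fun u : Gamma E => sec_app u m).
Proof. by []. Qed.

Lemma sec_app_sum (I : finType) (u : I -> Gamma E) m :
  sec_app (\sum_i u i) m = \sum_i sec_app (u i) m.
Proof. exact: (linear_sum (mk_linear (sec_app_linear m))). Qed.

Lemma dual_pair_linear m (v : tangent m) (xi : dual_section E) :
  linear (fun u => tangent_app v (dual_pair xi u) : R^o).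
Proof.
by move=> c u w; apply: tangent_add => p; exact: (linearP (dual_val xi p)).
Qed.

Lemma dual_pair_mul m (v : tangent m) (xi : dual_section E) f u :
  tangent_app v (dual_pair xi (Gamma_mul f u)) =
  f m * tangent_app v (dual_pair xi u) + dual_pair xi u m * tangent_app v f.
Proof.
by apply: tangent_leibniz => p; rewrite /= linearZ.
Qed.

Section Fibre.
Variable m : M.

Lemma jet_linear : linear (fun u => jet m u : Jet E m).
Proof.
move=> c u w; rewrite /jet Defs.pi_add; congr (_ + _).
by symmetry; exact: Defs.pi_scale.
Qed.

Lemma jet_ind (P : Jet E m -> Prop) : (forall u, P (jet m u)) -> forall mu, P mu.
Proof. by move=> H mu; rewrite -[mu]reprK; exact: H. Qed.

Lemma jet_proj_linear : linear (@jet_proj R n M r E m).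
Proof.
move=> c; elim/jet_ind => u; elim/jet_ind => w.
by rewrite -jet_linear !jet_projE.
Qed.

Definition jet_projL : {linear Jet E m -> E m} := mk_linear jet_proj_linear.

Lemma jet_proj_df f u : jet_proj (jet_df m f u) = 0 :> E m.
Proof.
rewrite -[LHS]/(jet_projL _) /jet_df linearB linearZ /= !jet_projE.
by rewrite subrr.
Qed.

(** The derivative of the component [<xi, u>] along [v] depends only on the
1-jet of [u]. *)
Definition jet_der (v : tangent m) (xi : dual_section E) (mu : Jet E m) : R :=
  tangent_app v (dual_pair xi (repr mu)).

Lemma jet_derE v xi u : jet_der v xi (jet m u) = tangent_app v (dual_pair xi u).
Proof.
have := piBP (reprK (jet m u)) => -[_ /(_ xi v)].
have := linearB (mk_linear (dual_pair_linear v xi)) (repr (jet m u)) u.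
by rewrite /= => -> /subr0_eq.
Qed.

Lemma jet_der_linear v xi : linear (jet_der v xi : Jet E m -> R^o).
Proof.
move=> c; elim/jet_ind => u; elim/jet_ind => w.
by rewrite -jet_linear !jet_derE dual_pair_linear.
Qed.

Definition jet_derL v xi : {linear Jet E m -> R^o} :=
  mk_linear (jet_der_linear v xi).

Lemma jet_der_df v xi f u :
  jet_der v xi (jet_df m f u) = tangent_app v f * dual_val xi m (sec_app u m).
Proof.
rewrite -[LHS]/(jet_derL v xi _) /jet_df linearB linearZ /= !jet_derE.
by rewrite dual_pair_mul addrC addKr mulrC.
Qed.

(** The product rule: every first factor vanishes at [m] together with its
derivative along [v]. *)
Lemma tangent_sum_products (v : tangent m) (I : Type) (s : seq I)
    (f g : I -> Cinf M) (h : Cinf M) : (forall p, h p = \sum_(i <- s) f i p * g i p) ->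
  (forall i, f i m = 0) -> (forall i, tangent_app v (f i) = 0) ->
  tangent_app v h = 0.
Proof.
move=> hE f0 df0; elim: s h hE => [|i s IH] h hE.
  by apply: (@tangent_cst _ _ _ _ _ _ setT 0) => // [|p _];
    [exact: openT | rewrite hE big_nil].
have sh : smooth_fun setT (fun p => \sum_(i <- s) f i p * g i p).
  apply: smooth_fun_sum => [|j]; first exact: openT.
  by apply: smooth_fun_mul; [exact: openT|exact: cvalP|exact: cvalP].
have sp : smooth_fun setT (fun p => f i p * g i p).
  by apply: smooth_fun_mul; [exact: openT|exact: cvalP|exact: cvalP].
rewrite (@tangent_add _ _ _ m v (CInf sp) (CInf sh) h 1); last first.
  by move=> p; rewrite hE big_cons mul1r.
rewrite (IH (CInf sh)) // (@tangent_leibniz _ _ _ _ v (f i) (g i)) //.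
by rewrite f0 df0 mul0r mulr0 !addr0 mulr0.
Qed.

End Fibre.

Lemma jet_vsec u : vsec (JE E) (fun m => jet m u).
Proof.
move=> m0; exists setT; split=> //; first exact: openT.
exists 1%N, (fun=> CInf (smooth_fun_cst setT 1)), (fun=> u) => m _.
by rewrite big_ord1 scale1r.
Qed.

Lemma jet_df_vsec f u : vsec (JE E) (fun m => jet_df m f u).
Proof.
move=> m0; exists setT; split=> //; first exact: openT.
have sN : smooth_fun setT (fun m => -1 * f m).
  by apply: smooth_fun_mul; [exact: openT|exact: smooth_fun_cst|exact: cvalP].
exists 2%N, (fun i => if i == 0 then CInf (smooth_fun_cst setT 1) else CInf sN),
  (fun i => if i == 0 then Gamma_mul f u else u) => m _.
by rewrite !big_ord_recl big_ord0 addr0 /= scale1r mulN1r scaleNr.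
Qed.

(** Sections of [JE] are locally combinations of prolongations with smooth
coefficients. *)
Lemma JE_smooth (phi : forall m, {linear Jet E m -> R^o}) :
  (forall u, smooth_fun setT (fun m => phi m (jet m u))) ->
  forall s, vsec (JE E) s -> smooth_fun setT (fun m => phi m (s m)).
Proof.
move=> sphi s Js; apply: smooth_fun_local => m0 _.
have [U [oU Um0 [N [f [u sE]]]]] := Js m0.
exists U, (fun m => \sum_i f i m * phi m (jet m (u i))); split=> //.
  apply: smooth_fun_sum => // i; apply: smooth_fun_mul => //.
    by apply: smooth_fun_sub (cvalP (f i)).
  by apply: smooth_fun_sub (sphi (u i)).
move=> p Up; rewrite sE // linear_sum; apply: eq_bigr => i _.
by rewrite linearZ.
Qed.

Lemma jet_proj_vsec s : vsec (JE E) s -> vsec E (fun m => jet_proj (s m)).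
Proof.
move=> Js; apply: bundle_sheaf => m0; have [U [oU Um0 [N [f [u sE]]]]] := Js m0.
exists U, (fun m => \sum_i f i m *: sec_app (u i) m); split=> //.
  by apply: module_sum => [|i]; [exact: bundle_module|exact: gammaP].
move=> p Up; rewrite sE // -[RHS]/(jet_projL _ _) linear_sum.
by apply: eq_bigr => i _; rewrite linearZ /= jet_projE.
Qed.

(** A frame of [E] together with coordinates.  The coordinate fields vanish
where the frame is not a basis, so that the operators built from them are
globally covariant differential operators. *)
Record adapted_frame (m0 : M) := AdaptedFrame {
  af_frame :> local_frame E 'I_r m0;
  af_dom : set M;
  af_open : open af_dom;
  af_mem : af_dom m0;
  af_field : 'I_n -> forall m, TM M m;
  af_coord : 'I_n -> Cinf M;
  af_fieldP : forall i, vsec (TM M) (af_field i);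
  af_support : forall i m, ~ lf_dom af_frame m -> af_field i m = 0;
  af_dual : forall m, af_dom m -> forall i j,
    tangent_app (af_field i m) (af_coord j) = (i == j)%:R;
  af_expand : forall m, af_dom m -> forall v : tangent m,
    v = \sum_i tangent_app v (af_coord i) *: af_field i m }.

Lemma adapted_frameP m0 : inhabited (adapted_frame m0).
Proof.
have [b] := bundle_framed E m0.
have [V [X [x [[oV Vm0] sX X0 Xx XE]]]] := coordinate_frame (lf_open b) (lf_mem b).
by constructor; exact: (@AdaptedFrame m0 b V oV Vm0 X x sX X0 Xx XE).
Qed.

Section AdaptedFrame.
Variables (m0 : M) (b : adapted_frame m0).

Definition af_sec (e : 'I_r) : Gamma E := gamma (lf_secP b e).

Definition af_xi (e : 'I_r) : dual_section E :=
  DualSection (fun u => lf_dualP b e (gammaP u)).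

Local Notation D := ('I_r + 'I_n * 'I_r)%type.

(** The frame is the jets of the frame [e] of [E] and the products [dx_i (x) e];
its dual is the components of the value and the derivatives of the components
along the coordinate fields. *)
Definition jet_frame_sec (d : D) m : Jet E m :=
  match d with
  | inl e => jet m (af_sec e)
  | inr (i, e) => jet_df m (af_coord b i) (af_sec e)
  end.

Definition jet_frame_dual (d : D) m : {linear Jet E m -> R^o} :=
  match d with
  | inl e => lf_dual b e m \o jet_projL m
  | inr (i, e) => jet_derL (af_field b i m) (af_xi e)
  end.

Lemma jet_frame_dualE m : af_dom b m -> lf_dom b m -> forall d d',
  jet_frame_dual d m (jet_frame_sec d' m) = (d == d')%:R.
Proof.
move=> xm bm [e|[i e]] [e'|[j e']] /=.
- by rewrite jet_projE /= lf_dualE.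
- by rewrite jet_proj_df linear0.
- rewrite jet_derE.
  rewrite (@tangent_cst _ _ _ _ _ _ (lf_dom b) (e == e')%:R) //; first exact: lf_open.
  by move=> p bp; rewrite /= lf_dualE.
- rewrite jet_der_df /= lf_dualE // af_dual //.
  by rewrite (inj_eq inr_inj) xpair_eqE mulr_natl -mulnb natrM mulr_natl.
Qed.

(** If the components of [u] in the frame vanish to first order at [m], then so
does every component [<eta, u>], which near [m] is their combination with
smooth coefficients. *)
Lemma jet_frame_dual_eq0 m (mu : Jet E m) : af_dom b m -> lf_dom b m ->
  (forall d, jet_frame_dual d m mu = 0) -> mu = 0.
Proof.
elim/jet_ind: mu => u xm bm H.
have u0 : sec_app u m = 0.
  rewrite (lf_expand bm (sec_app u m)) big1 // => e _.
  by have := H (inl e); rewrite /= jet_projE => ->; rewrite scale0r.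
have du0 e (v : tangent m) : tangent_app v (dual_pair (af_xi e) u) = 0.
  rewrite (af_expand xm v) tangent_app_sum big1 // => i _.
  by have := H (inr (i, e)); rewrite /= jet_derE => ->; rewrite mulr0.
have <- : jet m 0 = 0 :> Jet E m by exact: (linear0 (mk_linear (jet_linear m))).
apply: piB; rewrite subr0; split=> // eta v.
have sh : smooth_fun setT (fun p =>
    \sum_(e <- index_enum 'I_r) dual_pair (af_xi e) u p * dual_pair eta (af_sec e) p).
  apply: smooth_fun_sum => [|e]; first exact: openT.
  by apply: smooth_fun_mul; [exact: openT|exact: cvalP|exact: cvalP].
rewrite (@tangent_local _ _ _ _ _ _ (CInf sh) (lf_dom b) (lf_open b) bm).
  apply: (@tangent_sum_products _ _ _ (index_enum 'I_r)
    (fun e => dual_pair (af_xi e) u) (fun e => dual_pair eta (af_sec e))) => //.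
  by move=> e; rewrite /= u0 linear0.
move=> p bp; rewrite /= {1}(lf_expand bp (sec_app u p)) linear_sum.
by apply: eq_bigr => e _; rewrite linearZ.
Qed.

Lemma jet_frame_expand m : af_dom b m -> lf_dom b m -> forall mu : Jet E m,
  mu = \sum_d jet_frame_dual d m mu *: jet_frame_sec d m.
Proof.
move=> xm bm mu; apply/eqP; rewrite -subr_eq0; apply/eqP.
apply: jet_frame_dual_eq0 => // d; rewrite linearB linear_sum (bigD1 d) //=.
rewrite linearZ /= jet_frame_dualE // eqxx [_ *: _]mulr1 big1 ?addr0 ?subrr //.
by move=> d' d'd; rewrite linearZ /= jet_frame_dualE // eq_sym (negbTE d'd) scaler0.
Qed.

Lemma jet_frame_secP d : vsec (JE E) (jet_frame_sec d).
Proof. by case: d => [e|[i e]]; [exact: jet_vsec|exact: jet_df_vsec]. Qed.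

Lemma jet_frame_dualP d s : vsec (JE E) s ->
  smooth_fun setT (fun m => jet_frame_dual d m (s m)).
Proof.
apply: JE_smooth => u; case: d => [e|[i e]] /=.
  under eq_fun do rewrite jet_projE.
  exact: (cvalP (dual_pair (af_xi e) u)).
by under eq_fun do rewrite jet_derE; exact: af_fieldP.
Qed.

Definition jet_frame : local_frame (JE E) D m0 :=
  @LocalFrame _ _ _ (JE E) D m0 (af_dom b `&` lf_dom b)
    (openI (af_open b) (lf_open b)) (conj (af_mem b) (lf_mem b))
    jet_frame_sec jet_frame_dual jet_frame_secP jet_frame_dualP
    (fun m bm => jet_frame_expand bm.1 bm.2)
    (fun m bm => jet_frame_dualE bm.1 bm.2).

(** Linear lifts, by which maps on jets that depend only on the values of their
arguments descend to [E]. *)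
Definition jet_lift m (x : E m) : Jet E m :=
  \sum_e lf_dual b e m x *: jet m (af_sec e).

Lemma jet_lift_linear m : linear (@jet_lift m).
Proof.
move=> c x y; rewrite /jet_lift scaler_sumr -big_split /=.
by apply: eq_bigr => e _; rewrite linearP scalerDl scalerA.
Qed.

Lemma jet_liftK m (x : E m) : lf_dom b m -> jet_proj (jet_lift x) = x.
Proof.
move=> bm; rewrite -[LHS]/(jet_projL m _) linear_sum [RHS](lf_expand bm).
by apply: eq_bigr => e _; rewrite linearZ /= jet_projE.
Qed.

End AdaptedFrame.

End JetCalculus.

(** * Symbols of covariant differential operators *)

Lemma big_sum_pair (W : nmodType) (I J K : finType) (F : I + J * K -> W) :
  \sum_d F d = \sum_e F (inl e) + \sum_i \sum_e F (inr (i, e)).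
Proof.
rewrite big_sumType; congr (_ + _); rewrite pair_bigA /=.
by apply: eq_bigr => -[].
Qed.

Section Symbols.
Variables (R : realType) (n : nat) (M : manifold R n) (r : nat) (E : vbundle M r).

(** For [delta] in the gauge algebroid, [v] is its anchor [j(delta)]. *)
Definition symbol m (delta : Jet E m -> E m) (v : tangent m) :=
  forall f u, delta (jet_df m f u) = tangent_app v f *: sec_app u m.

Lemma DE_symbol m (delta : Jet E m -> E m) : DE delta ->
  linear delta /\ exists v, symbol delta v.
Proof.
move=> [d [dL [X sX dX]] dE]; have deltaL : linear delta.
  move=> c; elim/jet_ind => u; elim/jet_ind => w.
  by rewrite -jet_linear !dE dL.
split=> //; exists (X m) => f u.
have := linearB (mk_linear deltaL) (jet m (Gamma_mul f u)) (f m *: jet m u).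
rewrite /= -/(jet_df m f u) => ->.
have := linearZ_LR (mk_linear deltaL) (f m) (jet m u) => /= ->.
by rewrite !dE dX addrC addKr.
Qed.

Lemma symbol_linear m c (delta eps : Jet E m -> E m) v w :
  symbol delta v -> symbol eps w ->
  symbol (fun x => c *: delta x + eps x) (c *: v + w).
Proof.
by move=> sv sw f u; rewrite sv sw tangent_app_linear scalerDl scalerA.
Qed.

(** In an adapted frame a linear map with symbol [v] is the value at [m] of
[u |-> sum_e X (u_e) e + sum_e u_e a_e], where [X] is the field with constant
coefficients in the coordinate fields that extends [v], and where the sections
[a_e] extend the values on the prolongations of the frame. *)
Lemma symbol_DE m (delta : Jet E m -> E m) (v : tangent m) :
  linear delta -> symbol delta v -> DE delta.
Proof.
move=> deltaL sdelta; have [b] := adapted_frameP E m.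
pose X p : TM M p := \sum_i tangent_app v (af_coord b i) *: af_field b i p.
have sX : vsec (TM M) X.
  exact: (@module_sum _ _ _ (TM M) 'I_n (fun i => CInf (@smooth_fun_cst _ _ M setT
    (tangent_app v (af_coord b i)))) (af_field b) (@TM_module _ _ M) (af_fieldP b)).
have Xm : X m = v by rewrite [RHS](af_expand (af_mem b)).
have X0 p : ~ lf_dom b p -> X p = 0.
  by move=> bp; rewrite /X big1 // => i _; rewrite af_support // scaler0.
pose a e : Gamma E := \sum_e' Gamma_mul
  (CInf (smooth_fun_cst setT (lf_dual b e' m (delta (jet m (af_sec b e))))))
  (af_sec b e').
have am e : sec_app (a e) m = delta (jet m (af_sec b e)).
  by rewrite sec_app_sum [RHS](lf_expand (lf_mem b)).
pose d1 u : Gamma E :=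
  \sum_e Gamma_mul (CInf (sX (dual_pair (af_xi b e) u))) (af_sec b e).
pose d2 u : Gamma E := \sum_e Gamma_mul (dual_pair (af_xi b e) u) (a e).
pose d u := d1 u + d2 u.
have dE u p : sec_app (d u) p =
    \sum_e tangent_app (X p) (dual_pair (af_xi b e) u) *: lf_sec b e p +
    \sum_e lf_dual b e p (sec_app u p) *: sec_app (a e) p.
  by rewrite -[LHS]/(sec_app (d1 u) p + sec_app (d2 u) p) !sec_app_sum.
exists d.
  split=> [c u w|].
    apply: gamma_ext => p; rewrite [RHS](_ : _ =
      c *: sec_app (d u) p + sec_app (d w) p) // !dE scalerDr !scaler_sumr.
    rewrite addrACA; congr (_ + _); rewrite -big_split /=; apply: eq_bigr => e _.
      by rewrite dual_pair_linear scalerDl scalerA.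
    by rewrite (linearP (lf_dual b e p)) scalerDl scalerA.
  exists X => // f u p; rewrite !dE scalerDr !scaler_sumr.
  under eq_bigr do rewrite dual_pair_mul scalerDl -scalerA.
  under [X in _ + X = _]eq_bigr do
    rewrite (linearZ_LR (lf_dual b _ p)) -scalerA.
  rewrite big_split /= addrAC; congr (_ + _ + _).
  under eq_bigr do rewrite mulrC -scalerA.
  rewrite -scaler_sumr; have [bp|nbp] := pselect (lf_dom b p).
    by rewrite [in RHS](lf_expand bp (sec_app u p)).
  by rewrite X0 // /tangent_app !scale0r.
move=> u; rewrite dE Xm.
have := linear_sum (mk_linear deltaL) => /= deltaS.
have := linearZ_LR (mk_linear deltaL) => /= deltaZ.
rewrite (jet_frame_expand (b := b) (af_mem b) (lf_mem b) (jet m u)) deltaS.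
rewrite big_sum_pair /= addrC; congr (_ + _); last first.
  by apply: eq_bigr => e _; rewrite deltaZ am jet_projE.
rewrite exchange_big; apply: eq_bigr => e _ /=.
under eq_bigr do rewrite deltaZ sdelta jet_derE scalerA mulrC.
rewrite -scaler_suml; congr (_ *: _).
by rewrite -tangent_app_sum -af_expand //; exact: af_mem.
Qed.
End Symbols.

(** * The symbol of an element of Hom(/\^k JE, E)_DE *)

Section Snoc.
Variables (k : nat) (V : Type).

Lemma snoc_max (mu : 'I_k -> V) x : snoc (k := k.+1) mu x ord_max = x.
Proof. by rewrite /snoc insubF //= ltnn. Qed.

Lemma snoc_lift (mu : 'I_k -> V) x j : snoc (k := k.+1) mu x (lift ord_max j) = mu j.
Proof.
rewrite /snoc; case: insubP => [i _ ij|]; last by rewrite lift_max ltn_ord.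
by congr mu; apply: val_inj; rewrite ij lift_max.
Qed.

Lemma eq_snoc (mu : 'I_k -> V) x (nu : 'I_k.+1 -> V) :
  (forall j, nu (lift ord_max j) = mu j) -> nu ord_max = x ->
  nu = snoc (k := k.+1) mu x.
Proof.
move=> numu nux; apply/funext => i.
by case: (unliftP ord_max i) => [j|] ->; rewrite ?snoc_lift ?snoc_max.
Qed.

End Snoc.

Lemma snoc_comp (k : nat) (V V' : Type) (g : V -> V') (mu : 'I_k -> V) x :
  (fun a => g (snoc (k := k.+1) mu x a)) =
  snoc (k := k.+1) (fun a => g (mu a)) (g x).
Proof. by apply: eq_snoc => [j|]; rewrite ?snoc_lift ?snoc_max. Qed.

Section SnocSubst.
Variables (R : realType) (k : nat) (V : lmodType R).

Lemma subst_snoc_last (mu : 'I_k -> V) x y :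
  subst_at (snoc (k := k.+1) mu y) ord_max x = snoc (k := k.+1) mu x.
Proof.
apply: eq_snoc => [j|]; rewrite /subst_at ?eqxx //.
by rewrite eq_sym (negbTE (neq_lift _ _)) snoc_lift.
Qed.

Lemma subst_snoc (mu : 'I_k -> V) j x y :
  subst_at (snoc (k := k.+1) mu y) (lift ord_max j) x =
  snoc (k := k.+1) (subst_at mu j x) y.
Proof.
apply: eq_snoc => [l|]; rewrite /subst_at.
  by rewrite (inj_eq lift_inj) snoc_lift.
by rewrite (negbTE (neq_lift _ _)) snoc_max.
Qed.

Lemma multilinear_snoc (W : lmodType R) (phi : ('I_k.+1 -> V) -> W) mu :
  multilinear phi -> linear (fun x => phi (snoc (k := k.+1) mu x)).
Proof.
move=> ml; have -> : (fun x => phi (snoc (k := k.+1) mu x)) =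
    (fun x => phi (subst_at (snoc (k := k.+1) mu 0) ord_max x)).
  by apply/funext => x; rewrite subst_snoc_last.
exact: ml.
Qed.

End SnocSubst.

Section SymbolMap.
Variables (R : realType) (n : nat) (M : manifold R n) (r : nat) (E : vbundle M r).
Variable m : M.

Lemma jet_proj_surj k (x : 'I_k -> E m) :
  exists mu : 'I_k -> Jet E m, x = fun a => jet_proj (mu a).
Proof.
have [b] := adapted_frameP E m; exists (fun a => jet_lift b (x a)).
by apply/funext => a; rewrite (jet_liftK _ (lf_mem b)).
Qed.

(** The kernel of [jet_proj] is spanned by the [df (x) u]. *)
Lemma symbol0_ker (delta : Jet E m -> E m) mu : linear delta -> symbol delta 0 ->
  jet_proj mu = 0 -> delta mu = 0.
Proof.
move=> deltaL sdelta pmu; have [b] := adapted_frameP E m.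
rewrite (jet_frame_expand (b := b) (af_mem b) (lf_mem b) mu).
have := linear_sum (mk_linear deltaL) => /= ->.
have := linearZ_LR (mk_linear deltaL) => /= deltaZ.
rewrite big1 // => -[e|[i e]] _; rewrite deltaZ /=.
  by rewrite pmu linear0 scale0r.
by rewrite sdelta /tangent_app !scale0r scaler0.
Qed.

(** Symbols are unique because the fibres of [E] are not zero. *)
Lemma symbol_inj (delta : Jet E m -> E m) v w : (0 < r)%N ->
  symbol delta v -> symbol delta w -> v = w.
Proof.
move=> r0 sv sw; have [b] := adapted_frameP E m; pose e := Ordinal r0.
apply: tangent_ext => f; have := sw f (af_sec b e); rewrite (sv f (af_sec b e)).
move/(congr1 (lf_dual b e m)); rewrite !linearZ /= (lf_dualE (lf_mem b)) eqxx.
by rewrite ![_ *: _]mulr1.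
Qed.

(** [hom_jet eta] is some decomposition of [eta] into products [df (x) u], and the
value of [delta] on it depends only on [eta] and the symbol.  A decomposition
exists: [eta = sum_i dx_i (x) u_i], where [u_i] extends the value of [eta] on
the [i]-th coordinate field. *)
Lemma hom_jet_symbol (delta : Jet E m -> E m) v (eta : {linear tangent m -> E m}) :
  linear delta -> symbol delta v -> delta (hom_jet eta) = eta v.
Proof.
move=> deltaL sdelta; rewrite /hom_jet; set A := (X in xget 0 X).
have : A (xget 0 A).
  apply: xgetPex; have [b] := adapted_frameP E m.
  pose u i : Gamma E := \sum_e Gamma_mul (CInf (@smooth_fun_cst _ _ M setT
    (lf_dual b e m (eta (af_field b i m))))) (af_sec b e).
  exists (\sum_i jet_df m (af_coord b i) (u i)); exists n, (af_coord b), u.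
  split=> // w; rewrite {1}(af_expand (af_mem b) w) linear_sum.
  apply: eq_bigr => i _; rewrite linearZ /=; congr (_ *: _).
  by rewrite sec_app_sum [LHS](lf_expand (lf_mem b)).
move=> [N [f [u [etaE ->]]]]; rewrite etaE.
have := linear_sum (mk_linear deltaL) => /= ->.
by apply: eq_bigr => i _; rewrite sdelta.
Qed.

Section Element.
Variable k : nat.

Definition mk_HomDE (phi : alt k (Jet E m) (E m)) (H : natural_set phi) : HomDE E k m :=
  Subsp (asboolT H : _ \in sp_pred (Subspace (natural_closed E k m))).

Lemma HomDE_ext (d d' : HomDE E k m) :
  (forall mu, DE_app d mu = DE_app d' mu) -> d = d'.
Proof. by move=> H; apply/val_inj/alt_ext. Qed.

Lemma DE_app_linear_left mu : linear (fun d : HomDE E k m => DE_app d mu).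
Proof. by []. Qed.

End Element.

Section Lambda.
Variables (k : nat) (d : HomDE E k.+1 m) (b : adapted_frame E m).

Lemma DE_app_alt : alt_set (DE_app d).
Proof. exact: altP. Qed.

Lemma DE_app_linear mu : linear (fun x => DE_app d (snoc mu x)).
Proof. by apply: multilinear_snoc; have [] := DE_app_alt. Qed.

Lemma symbol_exists mu : exists v, symbol (fun x => DE_app d (snoc mu x)) v.
Proof.
have /asboolP/(_ mu) := sp_valP d.
by move=> /DE_symbol[_ [v sv]]; exists v.
Qed.

Definition jet_symbol mu : tangent m := projT1 (cid (symbol_exists mu)).

Lemma jet_symbolP mu : symbol (fun x => DE_app d (snoc mu x)) (jet_symbol mu).
Proof. exact: projT2 (cid (symbol_exists mu)). Qed.

Hypothesis r2 : (2 <= r)%N.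

Lemma jet_symbol_eq mu v :
  symbol (fun x => DE_app d (snoc mu x)) v -> jet_symbol mu = v.
Proof. by apply: symbol_inj (jet_symbolP mu); exact: ltnW. Qed.

Lemma jet_symbol_alt : alt_set jet_symbol.
Proof.
have [ml al] := DE_app_alt; split=> [mu i c x y|mu i j ij mij].
  apply: jet_symbol_eq => f u; rewrite -subst_snoc ml !subst_snoc !jet_symbolP.
  by rewrite scalerA -scalerDl.
apply: jet_symbol_eq => f u; rewrite (al _ (lift ord_max i) (lift ord_max j)).
- by rewrite /tangent_app scale0r.
- by rewrite (inj_eq lift_inj).
- by rewrite !snoc_lift.
Qed.

(** Exchanging [dg (x) e] with a last argument [df (x) e'] compares a multiple
of [e'] with a multiple of [e]; as the rank is at least two, [e'] can be chosen
independent of [e]. *)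
Lemma jet_symbol_df mu i g e : mu i = jet_df m g (af_sec b e) -> jet_symbol mu = 0.
Proof.
move=> mui; have [e' ee'] : exists e' : 'I_r, e' != e.
  pose e0 := Ordinal (ltnW r2); pose e1 := Ordinal r2.
  by case: (eqVneq e0 e) => [<-|]; [exists e1 | exists e0].
apply: tangent_ext => f; rewrite [RHS]/tangent_app /=.
have := alt_transpose (snoc mu (jet_df m f (af_sec b e'))) DE_app_alt
  (neq_lift ord_max i).
have -> : snoc mu (jet_df m f (af_sec b e')) \o tperm ord_max (lift ord_max i) =
    snoc (subst_at mu i (jet_df m f (af_sec b e'))) (jet_df m g (af_sec b e)).
  apply: eq_snoc => [j|]; rewrite /= /subst_at.
    case: eqP => [->|/eqP ji]; first by rewrite tpermR snoc_max.
    by rewrite tpermD ?snoc_lift ?neq_lift // (inj_eq lift_inj) eq_sym.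
  by rewrite tpermL snoc_lift.
rewrite !jet_symbolP => /(congr1 (lf_dual b e' m)).
rewrite linearN !linearZ /= !(lf_dualE (lf_mem b)) eqxx (negbTE ee').
by rewrite scaler0 mulr1n [_ *: _]mulrN1 => /eqP; rewrite eq_sym oppr_eq0 => /eqP.
Qed.

(** By linearity, as the kernel of [jet_proj] is spanned by products [dx_j (x) e]. *)
Lemma jet_symbol_ker mu i : jet_proj (mu i) = 0 -> jet_symbol mu = 0.
Proof.
move=> pmu; have [ml _] := jet_symbol_alt.
rewrite -(subst_at_id mu i).
rewrite (jet_frame_expand (b := b) (af_mem b) (lf_mem b) (mu i)).
have := linear_sum (mk_linear (ml mu i)) => /= ->.
have := linearZ_LR (mk_linear (ml mu i)) => /= Z.
rewrite big1 // => -[e|[j e]] _; rewrite Z /=; first by rewrite pmu linear0 scale0r.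
by rewrite (@jet_symbol_df _ i (af_coord b j) e) ?scaler0 // /subst_at eqxx.
Qed.

(** As [jet_symbol] depends only on the values of its arguments, it can be
evaluated on the lifts of these values, which are linear in them. *)
Lemma lambda_exists : exists lam : alt k (E m) (tangent m), forall mu,
  symbol (fun x => DE_app d (snoc mu x)) (alt_app lam (fun a => jet_proj (mu a))).
Proof.
have [ml al] := jet_symbol_alt.
have lamA : alt_set (fun x : 'I_k -> E m => jet_symbol (fun a => jet_lift b (x a))).
  split=> [x i c y z|x i j ij xij]; last by apply: (al _ i j) => //; rewrite xij.
  have S w : (fun a => jet_lift b (subst_at x i w a)) =
      subst_at (fun a => jet_lift b (x a)) i (jet_lift b w).
    by apply/funext => a; rewrite /subst_at; case: eqP.
  by rewrite !S (jet_lift_linear b) ml.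
exists (mk_alt lamA) => mu.
suff H : jet_symbol (fun a => jet_lift b (jet_proj (mu a))) = jet_symbol mu.
  by have := jet_symbolP mu; rewrite -H.
apply: (multilinear_congr (P := fun nu => jet_proj nu = 0) ml).
  by move=> nu i; exact: jet_symbol_ker.
move=> i; rewrite -[LHS]/(jet_projL E m _) linearB /= (jet_liftK _ (lf_mem b)).
by rewrite subrr.
Qed.

(** The last argument may be changed by the kernel of [jet_proj]; by alternation
so may all the others. *)
Lemma symbol0_factor : (forall mu, symbol (fun x => DE_app d (snoc mu x)) 0) ->
  exists Phi : alt k.+1 (E m) (E m),
    forall mu, DE_app d mu = alt_app Phi (fun a => jet_proj (mu a)).
Proof.
move=> s0; have [ml al] := DE_app_alt.
have last0 mu x : jet_proj x = 0 -> DE_app d (snoc mu x) = 0.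
  exact: (symbol0_ker (@DE_app_linear mu) (s0 mu)).
have any0 mu i : jet_proj (mu i) = 0 -> DE_app d mu = 0.
  move=> mui; have snocE (nu : 'I_k.+1 -> Jet E m) :
      nu = snoc (fun j => nu (lift ord_max j)) (nu ord_max) by exact: eq_snoc.
  case: (eqVneq i ord_max) => [im|im].
    by rewrite (snocE mu) last0 // -im.
  apply/eqP; rewrite -oppr_eq0 -(alt_transpose mu DE_app_alt im); apply/eqP.
  by rewrite (snocE (mu \o _)) last0 //= tpermR.
have PhiA : alt_set (fun x : 'I_k.+1 -> E m => DE_app d (fun a => jet_lift b (x a))).
  split=> [x i c y z|x i j ij xij]; last by apply: (al _ i j) => //; rewrite xij.
  have S w : (fun a => jet_lift b (subst_at x i w a)) =
      subst_at (fun a => jet_lift b (x a)) i (jet_lift b w).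
    by apply/funext => a; rewrite /subst_at; case: eqP.
  by rewrite !S (jet_lift_linear b) ml.
exists (mk_alt PhiA) => mu.
apply: (multilinear_congr (P := fun nu => jet_proj nu = 0) ml any0) => i.
by rewrite -[LHS]/(jet_projL E m _) linearB /= (jet_liftK _ (lf_mem b)) subrr.
Qed.

End Lambda.

Lemma lambda_unique k (d : HomDE E k.+1 m) (lam lam' : alt k (E m) (tangent m)) :
  (0 < r)%N ->
  (forall mu, symbol (fun x => DE_app d (snoc mu x))
     (alt_app lam (fun a => jet_proj (mu a)))) ->
  (forall mu, symbol (fun x => DE_app d (snoc mu x))
     (alt_app lam' (fun a => jet_proj (mu a)))) -> lam = lam'.
Proof.
move=> r0 H H'; apply: alt_ext => x; have [mu ->] := jet_proj_surj x.
exact: symbol_inj (H mu) (H' mu).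
Qed.

(** The determinants below are [xi_(I 1) /\ ... /\ xi_(I k) /\ D], where [D] is
the derivative of the [e]-th component along the value of [lam] on the basis
vectors [I]; summed over [I] and [e] they give an element with symbol [lam],
up to the factor [k!] with which antisymmetrization expands [lam]. *)
Lemma lambda_surj k (lam : alt k (E m) (tangent m)) : exists d : HomDE E k.+1 m,
  forall mu, symbol (fun x => DE_app d (snoc mu x))
    (alt_app lam (fun a => jet_proj (mu a))).
Proof.
have [b] := adapted_frameP E m.
pose v (I : {ffun 'I_k -> 'I_r}) : tangent m :=
  alt_app lam (fun a => lf_sec b (I a) m).
pose ent (I : {ffun 'I_k -> 'I_r}) (e : 'I_r) (mu : Jet E m) (a : 'I_k.+1) : R :=
  if unlift ord_max a is Some j then lf_dual b (I j) m (jet_proj mu)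
  else jet_der (v I) (af_xi b e) mu.
have entL I e a : linear (fun mu => ent I e mu a : R^o).
  move=> c x y; rewrite /ent; case: unlift => [j|]; last exact: jet_der_linear.
  by rewrite jet_proj_linear linearP.
pose A I e (mu : 'I_k.+1 -> Jet E m) : 'M[R]_k.+1 := \matrix_(l, a) ent I e (mu l) a.
(* The last column of the matrix holds the derivative, and the last row belongs
   to the last argument, for which the other entries vanish below. *)
pose F mu : E m := \sum_e (k`!%:R^-1 * \sum_I \det (A I e mu)) *: lf_sec b e m.
have FA : alt_set F.
  split=> [mu i c x y|mu i j ij mij]; last first.
    rewrite /F big1 // => e _; rewrite big1 ?mulr0 ?scale0r // => I _.
    by apply: (determinant_alternate ij) => a; rewrite !mxE mij.
  rewrite /F scaler_sumr -big_split /=; apply: eq_bigr => e _.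
  rewrite scalerA -scalerDl; congr (_ *: _).
  rewrite mulrCA -mulrDr; congr (_ * _); rewrite mulr_sumr -big_split /=.
  apply: eq_bigr => I _; rewrite -[X in _ = _ + X]mul1r.
  apply: (determinant_multilinear (i0 := i)).
  - by apply/rowP => a; rewrite !mxE /subst_at eqxx entL mul1r.
  - apply/matrixP => l a; rewrite !mxE /subst_at eq_sym.
    by rewrite (negbTE (neq_lift _ _)).
  - apply/matrixP => l a; rewrite !mxE /subst_at eq_sym.
    by rewrite (negbTE (neq_lift _ _)).
have Fsym mu : symbol (fun x => F (snoc mu x)) (alt_app lam (fun a => jet_proj (mu a))).
  move=> f u; pose x a := jet_proj (mu a).
  pose B (I : {ffun 'I_k -> 'I_r}) : 'M[R]_k := \matrix_(l, a) lf_dual b (I a) m (x l).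
  have detA I e : \det (A I e (snoc mu (jet_df m f u))) =
      \det (B I) * (tangent_app (v I) f * lf_dual b e m (sec_app u m)).
    rewrite (expand_det_row _ ord_max) (bigD1 ord_max) //= big1 ?addr0.
      rewrite mxE snoc_max /ent unlift_none jet_der_df mulrC; congr (_ * _).
      rewrite /cofactor -signr_odd oddD addbb expr0 mul1r; congr (\det _).
      by apply/matrixP => l a; rewrite !mxE snoc_lift /ent liftK.
    move=> a; case: (unliftP ord_max a) => [j|] ->; last by rewrite eqxx.
    by move=> _; rewrite mxE snoc_max /ent liftK jet_proj_df linear0 mul0r.
  have lamE : alt_app lam x = \sum_(I : {ffun 'I_k -> 'I_r}) (k`!%:R^-1 * \det (B I)) *: v I.
    have [ml _] := altP lam.
    have := alt_expand x (altP lam) (lf_expand (lf_mem b)) (lf_dualE (lf_mem b)).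
    move/(congr1 (fun w => k`!%:R^-1 *: w)); rewrite scalerA mulVf ?scale1r.
      by move=> ->; rewrite scaler_sumr; apply: eq_bigr => I _; rewrite scalerA.
    by rewrite pnatr_eq0 -lt0n fact_gt0.
  rewrite -/x lamE tangent_app_sum [in RHS](lf_expand (lf_mem b) (sec_app u m)).
  rewrite scaler_sumr; apply: eq_bigr => e _; rewrite scalerA; congr (_ *: _).
  rewrite mulr_sumr mulr_suml; apply: eq_bigr => I _.
  by rewrite detA !mulrA.
have Fnat : natural_set (mk_alt FA).
  move=> mu; apply: symbol_DE (Fsym mu).
  by have [ml _] := FA; exact: multilinear_snoc.
by exists (mk_HomDE Fnat).
Qed.

End SymbolMap.

(** * The bundle Hom(/\^k JE, E)_DE *)

Section HomDEBundle.
Variables (R : realType) (n : nat) (M : manifold R n) (r : nat) (E : vbundle M r).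
Variable k : nat.

Local Notation D := ('I_r + 'I_n * 'I_r)%type.
Local Notation model := (alt k.+1 {ffun D -> R^o} {ffun 'I_r -> R^o}).

Definition HomDE_val m (d : HomDE E k.+1 m) : alt k.+1 (Jet E m) (E m) := sp_val d.

Lemma HomDE_val_linear m : linear (@HomDE_val m).
Proof. by []. Qed.

(** The maps whose value on [snoc x (dx_i (x) e)] is [w_i e] for numbers [w_i]
that depend on [x] alone; they are the coordinate form of the elements that
have a symbol. *)
Definition natural_model : set model := [set Phi : model | forall x, exists w : 'I_n -> R,
  forall i e q, alt_app Phi (snoc x (unit_vector R (inr (i, e)))) q = w i * (q == e)%:R].

Lemma natural_model_closed : [/\ natural_model 0,
  (forall Phi Psi, natural_model Phi -> natural_model Psi -> natural_model (Phi + Psi)) &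
  (forall (c : R) Phi, natural_model Phi -> natural_model (c *: Phi))].
Proof.
split=> [x|Phi Psi nPhi nPsi x|c Phi nPhi x].
- by exists (fun=> 0) => i e q; rewrite mul0r [LHS]ffunE.
- have [w wE] := nPhi x; have [z zE] := nPsi x; exists (fun i => w i + z i).
  by move=> i e q; rewrite [LHS]ffunE wE zE mulrDl.
- have [w wE] := nPhi x; exists (fun i => c * w i).
  by move=> i e q; rewrite [LHS]ffunE wE [LHS]mulrA.
Qed.

Section Frame.
Variables (m0 : M) (b : adapted_frame E m0).

Lemma down_natural m (d : HomDE E k.+1 m) :
  lf_dom (jet_frame b) m -> lf_dom b m ->
  natural_model (down (jet_frame b) b (HomDE_val d)).
Proof.
move=> [xm bm] _ x.
have [v sv] := symbol_exists d (fun a => \sum_d x a d *: jet_frame_sec b d m).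
exists (fun i => tangent_app v (af_coord b i)) => i e q; rewrite downE.
have -> : (fun a => \sum_d snoc x (unit_vector R (inr (i, e))) a d *:
      jet_frame_sec b d m) =
    snoc (fun a => \sum_d x a d *: jet_frame_sec b d m)
      (jet_df m (af_coord b i) (af_sec b e)).
  rewrite (snoc_comp (fun y : {ffun D -> R^o} =>
    \sum_d y d *: jet_frame_sec b d m)); congr snoc.
  rewrite (bigD1 (inr (i, e))) //= ffunE eqxx scale1r big1 ?addr0 // => d' /negbTE ne.
  by rewrite ffunE ne scale0r.
have := sv (af_coord b i) (af_sec b e).
rewrite /DE_app -/(HomDE_val d) => ->.
by rewrite linearZ /= lf_dualE.
Qed.

(** Off the domain of the frame of [E] the coordinate fields vanish, and the
transported map has symbol [0]; on it the symbol is [sum_i w_i X_i]. *)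
Lemma up_natural m Phi : natural_model Phi ->
  natural_set (up (jet_frame b) b m Phi).
Proof.
move=> nPhi mu; pose x a := [ffun d => jet_frame_dual b d m (mu a)] : {ffun D -> R^o}.
have [w wE] := nPhi x.
have [ml _] := altP (up (jet_frame b) b m Phi).
apply: (@symbol_DE _ _ _ _ _ _ _ (\sum_i w i *: af_field b i m)).
  exact: multilinear_snoc.
move=> f u; rewrite -[LHS]/(alt_app (up (jet_frame b) b m Phi) (snoc mu (jet_df m f u))) upE.
have [mlP _] := altP Phi.
have dualE : [ffun d => jet_frame_dual b d m (jet_df m f u)] =
    \sum_i \sum_e (tangent_app (af_field b i m) f * lf_dual b e m (sec_app u m)) *:
      unit_vector R (inr (i, e)) :> {ffun D -> R^o}.
  rewrite {1}[LHS]unit_vector_expand big_sum_pair big1 ?add0r.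
    apply: eq_bigr => i _; apply: eq_bigr => e _; rewrite ffunE /=.
    by rewrite jet_der_df.
  by move=> e _; rewrite ffunE /= jet_proj_df linear0 scale0r.
have coef q : alt_app Phi (fun a => [ffun d => lf_dual (jet_frame b) d m
      (snoc mu (jet_df m f u) a)]) q =
    (\sum_i w i * tangent_app (af_field b i m) f) * lf_dual b q m (sec_app u m).
  have -> : (fun a => [ffun d => lf_dual (jet_frame b) d m
      (snoc mu (jet_df m f u) a)] : {ffun D -> R^o}) =
      snoc x [ffun d => jet_frame_dual b d m (jet_df m f u)].
    by rewrite -(snoc_comp (fun y => [ffun d => jet_frame_dual b d m y])).
  rewrite dualE.
  have := linear_sum (mk_linear (multilinear_snoc x mlP)) => /= S.
  have := linearZ_LR (mk_linear (multilinear_snoc x mlP)) => /= Z.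
  rewrite S sum_ffunE mulr_suml; apply: eq_bigr => i _.
  rewrite S sum_ffunE (bigD1 q) //= Z ffunE wE eqxx mulr1.
  rewrite big1 ?addr0 => [|e eq]; last first.
    by rewrite Z ffunE wE eq_sym (negbTE eq) mulr0 scaler0.
  by rewrite [LHS]mulrC mulrA.
under eq_bigr do rewrite coef -scalerA.
rewrite -scaler_sumr -tangent_app_sum.
have [bm|nbm] := pselect (lf_dom b m); first by rewrite -lf_expand.
rewrite big1 => [|i _]; last by rewrite af_support // scaler0.
by rewrite /tangent_app !scale0r.
Qed.

End Frame.

Lemma HomDE_bundle : is_vector_bundle (HomDE E k.+1).
Proof.
apply: (@alt_subbundle _ _ _ k.+1 (JE E) E D 'I_r (HomDE E k.+1)
  (fun m => mk_linear (@HomDE_val_linear m)) (Subspace natural_model_closed)).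
- exact: bundle_sheaf.
- exact: bundle_module.
- by move=> m d d' /= dd'; apply: HomDE_ext => mu; rewrite /DE_app -!/(HomDE_val _) dd'.
- by [].
move=> m0; have [b] := adapted_frameP E m0; exists (jet_frame b), b; split.
  by move=> m xm bm d; exact: down_natural.
by move=> Phi m nPhi; exists (mk_HomDE (@up_natural _ b m _ nPhi)).
Qed.

End HomDEBundle.

(** * The exact sequence *)

Section ExactSequence.
Variables (R : realType) (n : nat) (M : manifold R n) (r : nat) (E : vbundle M r).
Variable k : nat.

Lemma pullback_alt m (Phi : alt k.+1 (E m) (E m)) :
  alt_set (fun mu : 'I_k.+1 -> Jet E m => alt_app Phi (fun a => jet_proj (mu a))).
Proof.
have [ml al] := altP Phi; split=> [mu l c x y|mu l l' ll' mul].
  have S z : (fun a => jet_proj (subst_at mu l z a)) =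
      subst_at (fun a => jet_proj (mu a)) l (jet_proj z).
    by apply/funext => a; rewrite /subst_at; case: eqP.
  by rewrite !S jet_proj_linear ml.
by apply: (al _ l l') => //; rewrite mul.
Qed.

Lemma pullback_symbol m Phi (mu : 'I_k -> Jet E m) :
  symbol (fun x => alt_app (mk_alt (pullback_alt Phi)) (snoc (k := k.+1) mu x)) 0.
Proof.
move=> f u; rewrite /tangent_app scale0r; have [ml _] := altP Phi.
by apply: (multilinear0 (i := ord_max) ml); rewrite snoc_max jet_proj_df.
Qed.

Lemma pullback_natural m (Phi : alt k.+1 (E m) (E m)) :
  natural_set (mk_alt (pullback_alt Phi)).
Proof.
move=> mu; apply: symbol_DE (pullback_symbol Phi mu).
by have [ml _] := pullback_alt Phi; exact: multilinear_snoc.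
Qed.

Definition pullback m (Phi : alt k.+1 (E m) (E m)) : HomDE E k.+1 m :=
  mk_HomDE (pullback_natural Phi).

Lemma pullback_linear m : linear (@pullback m).
Proof. by move=> c Phi Psi; exact: HomDE_ext. Qed.

Lemma pullbackE m (Phi : alt k.+1 (E m) (E m)) mu :
  DE_app (pullback Phi) mu = alt_app Phi (fun a => jet_proj (mu a)).
Proof. by []. Qed.

Hypothesis r2 : (2 <= r)%N.
Let r0 : (0 < r)%N := ltnW r2.

Lemma symbol_map_exists m (d : HomDE E k.+1 m) :
  exists lam : alt k (E m) (tangent m), forall mu,
  symbol (fun x => DE_app d (snoc mu x)) (alt_app lam (fun a => jet_proj (mu a))).
Proof. by have [b] := adapted_frameP E m; exact: (lambda_exists d b r2). Qed.

Definition symbol_map m (d : HomDE E k.+1 m) : alt k (E m) (tangent m) :=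
  projT1 (cid (symbol_map_exists d)).

Lemma symbol_mapP m (d : HomDE E k.+1 m) mu : symbol (fun x => DE_app d (snoc mu x))
  (alt_app (symbol_map d) (fun a => jet_proj (mu a))).
Proof. exact: projT2 (cid (symbol_map_exists d)) mu. Qed.

Lemma symbol_map_eq m (d : HomDE E k.+1 m) lam : (forall mu,
  symbol (fun x => DE_app d (snoc mu x)) (alt_app lam (fun a => jet_proj (mu a)))) ->
  symbol_map d = lam.
Proof. exact: (lambda_unique r0 (symbol_mapP d)). Qed.

Lemma symbol_map_linear m : linear (@symbol_map m).
Proof.
move=> c d d'; apply: symbol_map_eq => mu.
have -> : alt_app (c *: symbol_map d + symbol_map d') (fun a => jet_proj (mu a)) =
    c *: alt_app (symbol_map d) (fun a => jet_proj (mu a)) +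
    alt_app (symbol_map d') (fun a => jet_proj (mu a)) by exact: alt_app_linear.
have -> : (fun x => DE_app (c *: d + d') (snoc mu x)) =
    (fun x => c *: DE_app d (snoc mu x) + DE_app d' (snoc mu x)).
  by apply/funext => x; exact: DE_app_linear_left.
exact: symbol_linear (symbol_mapP d mu) (symbol_mapP d' mu).
Qed.

Lemma symbol_map_hom_jet m (d : HomDE E k.+1 m) lam : symbol_map d = lam <->
  forall (mu : 'I_k -> Jet E m) (eta : {linear tangent m -> E m}),
    DE_app d (snoc (k := k.+1) mu (hom_jet eta)) = eta (alt_app lam (fun a => jet_proj (mu a))).
Proof.
have homE mu eta := hom_jet_symbol eta (DE_app_linear d mu) (symbol_mapP d mu).
split=> [<- //|H]; apply: alt_ext => x; have [mu ->] := jet_proj_surj x.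
have [b] := adapted_frameP E m; pose e := Ordinal r0; apply: tangent_ext => f.
have etaL : linear (fun v : tangent m => tangent_app v f *: lf_sec b e m).
  by move=> c v w; rewrite tangent_app_linear scalerDl scalerA.
have := etrans (esym (homE mu (mk_linear etaL))) (H mu (mk_linear etaL)).
move/(congr1 (lf_dual b e m)); rewrite /= !linearZ /= (lf_dualE (lf_mem b)) eqxx.
by rewrite ![_ *: _]mulr1.
Qed.

Lemma pullback_inj m : injective (@pullback m).
Proof.
move=> Phi Psi PP; apply: alt_ext => x; have [mu ->] := jet_proj_surj x.
by rewrite -!pullbackE PP.
Qed.

Lemma symbol_map_kernel m (d : HomDE E k.+1 m) :
  symbol_map d = 0 <-> exists Phi, pullback Phi = d.
Proof.
split=> [d0|[Phi <-]]; last by apply: symbol_map_eq => mu; exact: pullback_symbol.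
have [b] := adapted_frameP E m.
have [|Phi PhiE] := @symbol0_factor _ _ _ _ _ _ _ d b.
  by move=> mu; have := symbol_mapP d mu; rewrite d0.
by exists Phi; apply: HomDE_ext => mu; rewrite PhiE.
Qed.

Lemma symbol_map_surj m (lam : alt k (E m) (tangent m)) :
  exists d : HomDE E k.+1 m, symbol_map d = lam.
Proof. by have [d dP] := lambda_surj lam; exists d; exact: symbol_map_eq. Qed.

Lemma pullback_smooth (Phi : forall m, alt k.+1 (E m) (E m)) :
  vsec (HomAlt k.+1 E E) Phi -> vsec (HomDE E k.+1) (fun m => pullback (Phi m)).
Proof.
move=> hPhi s Js; apply: (hPhi (fun a m => jet_proj (s a m))) => a.
exact: jet_proj_vsec.
Qed.

(** Near a point, [lam (u_1, .., u_k) f] is the component of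
[d (du_1, .., du_k, df (x) e)] along a section [e] of a frame. *)
Lemma symbol_map_smooth (d : forall m, HomDE E k.+1 m) :
  vsec (HomDE E k.+1) d -> vsec (HomAlt k E (TM M)) (fun m => symbol_map (d m)).
Proof.
move=> hd s Es f; apply: smooth_fun_local => m0 _.
have [b] := adapted_frameP E m0; pose e := Ordinal r0.
pose mu (a : 'I_k) m : Jet E m := jet m (gamma (Es a)).
pose nu m : Jet E m := jet_df m f (af_sec b e).
have Js : vsec E (fun m => DE_app (d m) (snoc (k := k.+1) (mu^~ m) (nu m))).
  have -> : (fun m => DE_app (d m) (snoc (k := k.+1) (mu^~ m) (nu m))) =
      (fun m => DE_app (d m) (fun a => snoc (k := k.+1) mu nu a m)).
    apply/functional_extensionality_dep => m.
    by rewrite (snoc_comp (fun t : forall m, Jet E m => t m)).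
  apply: (hd (snoc (k := k.+1) mu nu)) => a; rewrite /snoc; case: insub => [a'|].
    exact: jet_vsec.
  exact: jet_df_vsec.
exists (lf_dom b), (fun m => lf_dual b e m (DE_app (d m) (snoc (k := k.+1) (mu^~ m) (nu m)))).
split; [exact: lf_open|exact: lf_mem| |].
  by apply: (@smooth_fun_sub _ _ _ _ setT) => //; exact: (lf_dualP b e Js).
move=> m bm; rewrite (symbol_mapP (d m) (mu^~ m) f (af_sec b e)).
rewrite linearZ /= lf_dualE // eqxx [_ *: _]mulr1.
congr (tangent_app (alt_app _ _) f); apply/funext => a.
exact: jet_projE.
Qed.

End ExactSequence.

Theorem theorem3p3 (R : realType) (n : nat) (M : manifold R n) (r : nat)
    (E : vbundle M r) (hr : (2 <= r)%N) (k : nat) (hk : (1 <= k)%N) :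
  exists (i : forall m : M, {linear HomAlt k E E m -> HomDE E k m})
         (j : forall m : M, {linear HomDE E k m -> HomAlt k.-1 E (TM M) m}),
    [/\ short_exact_sequence i j,
        forall (m : M) (Phi : HomAlt k E E m) (mu : 'I_k -> Jet E m),
          DE_app (i m Phi) mu = alt_app Phi (fun a => jet_proj (mu a)) &
        forall (m : M) (d : HomDE E k m) (lam : HomAlt k.-1 E (TM M) m),
          j m d = lam <->
          forall (mu : 'I_k.-1 -> Jet E m) (eta : {linear tangent m -> E m}),
            DE_app d (snoc mu (hom_jet eta))
              = eta (alt_app lam (fun a => jet_proj (mu a)))].
Proof.
case: k hk => // k _.
exists (fun m => mk_linear (@pullback_linear _ _ _ _ E k m)),
  (fun m => mk_linear (symbol_map_linear hr (m := m))); split.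
- split.
  + split.
    * by apply: HomAlt_bundle; [exact: bundle_sheaf|exact: bundle_module|
        exact: bundle_framed|exact: bundle_framed].
    * exact: HomDE_bundle.
    * by apply: HomAlt_bundle; [exact: TM_sheaf|exact: TM_module|
        exact: bundle_framed|exact: TM_framed].
  + by split=> [Phi|d]; [exact: pullback_smooth|exact: symbol_map_smooth].
  + by move=> m; split; [exact: pullback_inj|exact: symbol_map_kernel|
      exact: symbol_map_surj].
- exact: pullbackE.
- exact: symbol_map_hom_jet.
Qed.
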